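(* Let $V$ be a finite-dimensional indecomposable metric 3-Lie algebra of index $r>0$ with a maximally isotropic centre. Then $V$ admits a vector space decomposition into $r+M+N+1$ mutually orthogonal subspaces $$V=\bigoplus_{i=1}^r\left(\mathbb{R}u_i\oplus\mathbb{R}v_i\right)\oplus\bigoplus_{\alpha=1}^N W_\alpha\oplus\bigoplus_{\pi=1}^M E_\pi\oplus E_0,$$ where $W_\alpha$, $E_\pi$ and $E_0$ are positive-definite subspaces, each $E_\pi$ is two-dimensional, and $\langle u_i,u_j\rangle=\langle v_i,v_j\rangle=0$, $\langle u_i,v_j\rangle=\delta_{ij}$. The 3-Lie algebra is defined in terms of the following data: - $0\neq\eta^\pi\wedge\zeta^\pi\in\Lambda^2\mathbb{R}^r$ for each $\pi=1,\dots,M$ (with $\eta^\pi,\zeta^\pi\in\mathbb{R}^r$), - $0\neq\kappa^\alpha\in\mathbb{R}^r$ for each $\alpha=1,\dots,N$, - a metric simple Lie algebra structure $\mathfrak{g}_\alpha$, with bracket $[-,-]$, on each $W_\alpha$ (metric with respect to the restriction of $\langle-,-\rangle$), - $L\in\Lambda^4\mathbb{R}^r$ (components $L_{ijk\ell}$, totally skewsymmetric), and - $K\in\Lambda^3\mathbb{R}^r\otimes E_0$ (components $K_{ijk}\in E_0$, totally skewsymmetric in $i,j,k$) subject to $$\langle K_{ijn},K_{k\ell m}\rangle+\langle K_{ij\ell},K_{mnk}\rangle-\langle K_{ijm},K_{nk\ell}\rangle-\langle K_{ijk},K_{\ell mn}\rangle=0\quad\text{for all }i,j,k,\ell,m,n,$$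 by the following 3-brackets (all 3-brackets not obtained from these by total skewsymmetry vanish; there is no summation over $\pi$): $$[u_i,u_j,u_k]=K_{ijk}+\sum_{\ell=1}^r L_{ijk\ell}v_\ell,\qquad [u_i,u_j,x_0]=-\sum_{k=1}^r\langle K_{ijk},x_0\rangle v_k,$$ $$[u_i,u_j,x_\pi]=J^\pi_{ij}H_\pi x_\pi,\qquad [u_i,x_\pi,y_\pi]=-\sum_{j=1}^r\langle x_\pi,J^\pi_{ij}H_\pi y_\pi\rangle v_j,$$ $$[u_i,x_\alpha,y_\alpha]=\kappa^\alpha_i[x_\alpha,y_\alpha],\qquad [x_\alpha,y_\alpha,z_\alpha]=-\langle[x_\alpha,y_\alpha],z_\alpha\rangle\sum_{i=1}^r\kappa^\alpha_i v_i,$$ for all $x_0\in E_0$, $x_\pi,y_\pi\in E_\pi$, $x_\alpha,y_\alpha,z_\alpha\in W_\alpha$, where $J^\pi_{ij}=\eta^\pi_i\zeta^\pi_j-\eta^\pi_j\zeta^\pi_i$ and $H_\pi$ is a complex structure on the 2-plane $E_\pi$. The resulting 3-Lie algebra is indecomposable provided that there is no nonzero $x_0\in E_0$ perpendicular to all the $K_{ijk}$; in particular $\dim E_0\le\binom{r}{3}$.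
   Context: A (finite-dimensional real) 3-Lie algebra is a finite-dimensional real vector space $V$ with a totally skewsymmetric trilinear map $[-,-,-]:V^3\to V$ satisfying the fundamental identity $[x,y,[z,s,t]]=[[x,y,z],s,t]+[z,[x,y,s],t]+[z,s,[x,y,t]]$. It is metric if it carries a nondegenerate symmetric bilinear form $\langle-,-\rangle$ with $\langle[x,y,z],s\rangle+\langle z,[x,y,s]\rangle=0$ for all $x,y,z,s$. The index is the number of negative eigenvalues of $\langle-,-\rangle$. An orthogonal direct sum of metric 3-Lie algebras $V_1\oplus V_2$ has $[x_1,x_2,y]=0$ and $\langle x_1,x_2\rangle=0$ for $x_i\in V_i$; $V$ is indecomposable if it is not isomorphic to such a sum with both $\dim V_i>0$. The centre is $Z=\{z\in V:[z,x,y]=0\ \forall x,y\in V\}$. $V$ has a maximally isotropic centre if its centre $Z$ has dimension equal to the index $r$ and $\langle Z,Z\rangle=0$.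
   Formalization: The last sentence is proved as a necessary condition: in the indecomposable V no nonzero x_0 in E_0 is perpendicular to all K_ijk, so dim E_0 ≤ C(r,3). As a sufficient condition it fails: r=2, E_0=0, K=L=0, N=2, M=0, κ¹=(1,0), κ²=(0,1) gives a decomposable algebra. *)

(* Defs.v *)
(* A real vector space of dimension n is 'rV[R]_n with
   R : realType; subspaces are represented by row spaces of matrices
   (mxalgebra, scope %MS), and the bilinear form by its Gram matrix G. *)
From HB Require Import structures.
From mathcomp Require Import all_boot all_order all_algebra.
From mathcomp Require Import reals.
Set Implicit Arguments.
Unset Strict Implicit.
Unset Printing Implicit Defensive.
Import Order.TTheory GRing.Theory Num.Theory.
Local Open Scope ring_scope.

Section Defs.
Variables (R : realType) (n : nat).
Local Notation V := 'rV[R]_n.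

Definition bform (G : 'M[R]_n) (x y : V) : R := (x *m G *m y^T) 0 0.

Definition trilinear3 (br : V -> V -> V -> V) : Prop :=
  (forall a x x' y z, br (a *: x + x') y z = a *: br x y z + br x' y z) /\
  (forall a x y y' z, br x (a *: y + y') z = a *: br x y z + br x y' z) /\
  (forall a x y z z', br x y (a *: z + z') = a *: br x y z + br x y z').

Definition totally_skew3 (br : V -> V -> V -> V) : Prop :=
  forall x y z, br x y z = - br y x z /\ br x y z = - br x z y.

Definition fundamental_identity (br : V -> V -> V -> V) : Prop :=
  forall x y z s t,
    br x y (br z s t) = br (br x y z) s t + br z (br x y s) t + br z s (br x y t).

Definition is_3Lie (br : V -> V -> V -> V) : Prop :=
  [/\ trilinear3 br, totally_skew3 br & fundamental_identity br].

Definition is_metric3 (G : 'M[R]_n) (br : V -> V -> V -> V) : Prop :=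
  [/\ G^T = G, G \in unitmx &
      forall x y z s, bform G (br x y z) s + bform G z (br x y s) = 0].

(* index = number of negative eigenvalues (with multiplicity) of the
   (symmetric) Gram matrix G, i.e. of the roots of its characteristic
   polynomial *)
Definition index_of (G : 'M[R]_n) (r : nat) : Prop :=
  exists s : seq R, char_poly G = \prod_(a <- s) ('X - a%:P) /\
                    count (fun a => a < 0) s = r.

Definition central (br : V -> V -> V -> V) (z : V) : Prop :=
  forall x y, br z x y = 0.

Definition max_isotropic_centre (G : 'M[R]_n) (br : V -> V -> V -> V)
    (r : nat) : Prop :=
  exists Z : 'M[R]_n,
    [/\ (forall z : V, (z <= Z)%MS <-> central br z),
        \rank Z = r &
        forall z z' : V, (z <= Z)%MS -> (z' <= Z)%MS -> bform G z z' = 0].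

Definition orth (G : 'M[R]_n) m1 m2 (A : 'M[R]_(m1, n)) (B : 'M[R]_(m2, n)) :=
  forall x y : V, (x <= A)%MS -> (y <= B)%MS -> bform G x y = 0.

Definition closed3 (br : V -> V -> V -> V) (U : 'M[R]_n) : Prop :=
  forall x y z : V, (x <= U)%MS -> (y <= U)%MS -> (z <= U)%MS ->
    (br x y z <= U)%MS.

Definition decomposable (G : 'M[R]_n) (br : V -> V -> V -> V) : Prop :=
  exists U1 U2 : 'M[R]_n,
    [/\ (0 < \rank U1)%N /\ (0 < \rank U2)%N,
        ((U1 + U2 == (1%:M : 'M[R]_n))%MS /\ mxdirect (U1 + U2)),
        orth G U1 U2,
        (forall x y z : V, (x <= U1)%MS -> (y <= U2)%MS -> br x y z = 0) &
        (closed3 br U1 /\ closed3 br U2)].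

Definition indecomposable G br : Prop := ~ decomposable G br.

Definition posdef (G : 'M[R]_n) (E : 'M[R]_n) : Prop :=
  forall x : V, (x <= E)%MS -> x != 0 -> 0 < bform G x x.

Definition metric_simple_Lie (G : 'M[R]_n) (W : 'M[R]_n) (lb : V -> V -> V)
    : Prop :=
  [/\ forall x y : V, (x <= W)%MS -> (y <= W)%MS -> (lb x y <= W)%MS,
      forall a (x x' y : V), (x <= W)%MS -> (x' <= W)%MS -> (y <= W)%MS ->
        lb (a *: x + x') y = a *: lb x y + lb x' y /\
        lb y (a *: x + x') = a *: lb y x + lb y x',
      forall x y z : V, (x <= W)%MS -> (y <= W)%MS -> (z <= W)%MS ->
        lb x y = - lb y x /\
        lb x (lb y z) + lb y (lb z x) + lb z (lb x y) = 0,
      ((forall x y z : V, (x <= W)%MS -> (y <= W)%MS -> (z <= W)%MS ->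
        bform G (lb x y) z + bform G y (lb x z) = 0) /\
      (forall x : V, (x <= W)%MS ->
        (forall y : V, (y <= W)%MS -> bform G x y = 0) -> x = 0)) &
      ((exists x y : V, [/\ (x <= W)%MS, (y <= W)%MS & lb x y != 0]) /\
      (forall I : 'M[R]_n, (I <= W)%MS ->
        (forall x y : V, (x <= W)%MS -> (y <= I)%MS -> (lb x y <= I)%MS) ->
        (I == (0 : 'M[R]_n))%MS \/ (I == W)%MS))].

Definition complex_structure (E : 'M[R]_n) (H : V -> V) : Prop :=
  [/\ forall x : V, (x <= E)%MS -> (H x <= E)%MS,
      (forall a (x y : V), (x <= E)%MS -> (y <= E)%MS ->
        H (a *: x + y) = a *: H x + H y) &
      forall x : V, (x <= E)%MS -> H (H x) = - x].

End Defs.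

Definition skew3_arr (T : zmodType) r (K : 'I_r -> 'I_r -> 'I_r -> T) :=
  forall i j k, K i j k = - K j i k /\ K i j k = - K i k j.

Definition skew4_arr (T : zmodType) r
    (L : 'I_r -> 'I_r -> 'I_r -> 'I_r -> T) :=
  forall i j k l, [/\ L i j k l = - L j i k l, L i j k l = - L i k j l &
                      L i j k l = - L i j l k].

Definition Jc (R : nzRingType) M r (eta zeta : 'I_M -> 'I_r -> R) p i j : R :=
  eta p i * zeta p j - eta p j * zeta p i.

Inductive piece (M N : nat) : Type := P0 | PE of 'I_M | PW of 'I_N.
Arguments P0 {M N}.
Arguments PE {M N}.
Arguments PW {M N}.

Definition piece_sp (R : realType) n M N (E0 : 'M[R]_n) (E : 'I_M -> 'M[R]_n)
    (W : 'I_N -> 'M[R]_n) (A : piece M N) : 'M[R]_n :=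
  match A with P0 => E0 | PE p => E p | PW a => W a end.

Definition br_uxy (R : realType) n r M N (G : 'M[R]_n)
    (v : 'I_r -> 'rV[R]_n) (eta zeta : 'I_M -> 'I_r -> R)
    (H : 'I_M -> 'rV[R]_n -> 'rV[R]_n)
    (kappa : 'I_N -> 'I_r -> R) (lb : 'I_N -> 'rV[R]_n -> 'rV[R]_n -> 'rV[R]_n)
    (i : 'I_r) (A B : piece M N) (x y : 'rV[R]_n) : 'rV[R]_n :=
  match A, B with
  | PE p, PE q => if p == q then
                    - \sum_(j < r) bform G x (Jc eta zeta p i j *: H p y) *: v j
                  else 0
  | PW a, PW b => if a == b then kappa a i *: lb a x y else 0
  | _, _ => 0
  end.

Definition br_xyz (R : realType) n r M N (G : 'M[R]_n)
    (v : 'I_r -> 'rV[R]_n) (kappa : 'I_N -> 'I_r -> R)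
    (lb : 'I_N -> 'rV[R]_n -> 'rV[R]_n -> 'rV[R]_n)
    (A B C : piece M N) (x y z : 'rV[R]_n) : 'rV[R]_n :=
  match A, B, C with
  | PW a, PW b, PW c =>
      if (a == b) && (b == c) then
        - (bform G (lb a x y) z *: \sum_(i < r) kappa a i *: v i)
      else 0
  | _, _, _ => 0
  end.

(* Main.v *)
(* The quotient Z^perp / Z of the orthogonal of the centre by the centre is a
   Euclidean space on which all the operators ad(a,b) = [a,b,-] act by skew
   endomorphisms, so it splits into orthogonal irreducible summands, and brackets
   of elements in different summands vanish. Vectors u_i dual to a basis of Z may
   be changed by elements of Z^perp, and on each irreducible summand this freedom
   normalizes the bracket:
   - if [x,y,z] <> 0 mod Z for some x, y, z in the summand, it decouples the
     summand from everything else, against indecomposability;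
   - otherwise, if some [u_i,x,y] <> 0, Schur's lemma applied to a mixed Casimir
     operator makes all the brackets [u_i,-,-] proportional to a single simple Lie
     bracket, the skew derivations [u_i,u_j,-] are inner and can be removed;
   - otherwise the operators [u_i,u_j,-] commute, so they vanish or the summand is
     a plane and they are multiples J_ij H of a rotation; the fundamental identity
     is then the Pluecker relation for J and allows one to remove K_ijk.
   The summands on which every ad(a,b) vanishes add up to E_0. *)
Require Import Defs.
From HB Require Import structures.
From mathcomp Require Import all_boot all_order all_algebra.
From mathcomp Require Import reals.
From mathcomp Require Import boolp.
From mathcomp Require Import complex spectral.
From mathcomp Require Import ring lra zify.
Set Implicit Arguments.
Unset Strict Implicit.
Unset Printing Implicit Defensive.
Import Order.TTheory GRing.Theory Num.Theory.
Local Open Scope ring_scope.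

(** The quotient Z^perp / Z is never formed. A summand is a matrix [C] whose rows are orthonormal
    lifts, and its operators are read in coordinates by [D C a b]. Lifts are defined only up to Z,
    so everything is first proved modulo Z. The central components come last: they are pairings with
    the u_i, and as <[a,b,c],d> is an alternating four-form, each of them is a component of another
    bracket that is already known.

    On one summand the data are ad of two of its vectors, ad of some u_i and one of its vectors, ad
    of u_i and u_j, and the component of [u_i,u_j,u_k]. The case distinction asks which of the three
    kinds of ad is the first nonzero one.

    Over the reals, Schur's lemma in general yields only a division algebra. It is applied here to
    symmetric intertwiners alone, which have a real eigenvector and are therefore scalars.

    Each summand asks for its own change of the u_i. These changes do not interfere: a shift by a
    vector of Z^perp orthogonal to [C] alters neither the operators on [C] nor the components in
    [C]. One choice of u_i thus normalizes all summands. *)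

Section Euclid.
Variable R : realType.

(** * The dot product and real eigenvectors of symmetric matrices *)

Definition dot m (x y : 'rV[R]_m) : R := (x *m y^T) 0 0.

Lemma dotE m (x y : 'rV[R]_m) : dot x y = \sum_i x 0 i * y 0 i.
Proof. by rewrite /dot mxE; apply: eq_bigr => i _; rewrite mxE. Qed.

Lemma dotC m (x y : 'rV[R]_m) : dot x y = dot y x.
Proof. by rewrite !dotE; apply: eq_bigr => i _; rewrite mulrC. Qed.

Lemma dotDl m (x y z : 'rV[R]_m) : dot (x + y) z = dot x z + dot y z.
Proof. by rewrite /dot mulmxDl mxE. Qed.

Lemma dotZl m a (x y : 'rV[R]_m) : dot (a *: x) y = a * dot x y.
Proof. by rewrite /dot -scalemxAl mxE. Qed.

Lemma dotNr m (x y : 'rV[R]_m) : dot x (- y) = - dot x y.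
Proof. by rewrite /dot linearN mulmxN mxE. Qed.

Lemma dot_delta m (x : 'rV[R]_m) l : dot x (delta_mx 0 l) = x 0 l.
Proof. by rewrite /dot trmx_delta -colE mxE. Qed.

Lemma dotM m p (x : 'rV[R]_m) (A : 'M_(m, p)) (y : 'rV[R]_p) :
  dot (x *m A) y = dot x (y *m A^T).
Proof. by rewrite /dot trmx_mul trmxK mulmxA. Qed.

Lemma dot_ge0 m (x : 'rV[R]_m) : 0 <= dot x x.
Proof. by rewrite dotE sumr_ge0 // => i _; rewrite -expr2 sqr_ge0. Qed.

Lemma dot_eq0 m (x : 'rV[R]_m) : dot x x = 0 -> x = 0.
Proof.
rewrite dotE => /psumr_eq0P h; apply/rowP => i; rewrite mxE; apply/eqP.
by rewrite -sqrf_eq0 expr2 h // => j _; rewrite -expr2 sqr_ge0.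
Qed.

Lemma dot_gt0 m (x : 'rV[R]_m) : x != 0 -> 0 < dot x x.
Proof.
by move=> x0; rewrite lt_def dot_ge0 andbT; apply: contra x0 => /eqP/dot_eq0 ->.
Qed.

Lemma mxtrace_mulT m p (A : 'M[R]_(m, p)) :
  \tr (A *m A^T) = \sum_i dot (row i A) (row i A).
Proof.
apply: eq_bigr => i _; rewrite dotE !mxE.
by apply: eq_bigr => k _; rewrite !mxE.
Qed.

Lemma mxtrace_mulT_ge0 m p (A : 'M[R]_(m, p)) : 0 <= \tr (A *m A^T).
Proof. by rewrite mxtrace_mulT sumr_ge0 // => i _; apply: dot_ge0. Qed.

Lemma mxtrace_mulT_eq0 m p (A : 'M[R]_(m, p)) : \tr (A *m A^T) = 0 -> A = 0.
Proof.
rewrite mxtrace_mulT => /psumr_eq0P h; apply/row_matrixP => i; rewrite row0.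
by apply: dot_eq0; rewrite h // => j _; apply: dot_ge0.
Qed.

(* A complex eigenvector x + iy of a symmetric matrix, for the eigenvalue a + ib,
   satisfies b (|x|^2 + |y|^2) = 0. *)
Lemma sym_eigenvector m (S : 'M[R]_m) : (0 < m)%N -> S^T = S ->
  exists a, exists2 x : 'rV[R]_m, x != 0 & x *m S = a *: x.
Proof.
move=> m0 Ssym; pose SC := map_mx (real_complex R) S.
have /(eigenvalue_closed SC) [[a b] /eigenvalueP[z zS z0]] := m0.
pose x := map_mx (@complex.Re R) z; pose y := map_mx (@complex.Im R) z.
have zxy i : z 0 i = (x 0 i +i* y 0 i)%C by rewrite !mxE; case: (z 0 i).
have ES j : \sum_i z 0 i * SC i j = ((a +i* b)%C * z 0 j).
  by move/matrixP/(_ 0 j): zS; rewrite !mxE.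
have xS : x *m S = a *: x - b *: y.
  apply/rowP => j; move/(congr1 (@complex.Re R)): (ES j).
  rewrite raddf_sum zxy !mxE /= => <-; apply: eq_bigr => i _.
  by rewrite zxy !mxE /= mulr0 subr0.
have yS : y *m S = a *: y + b *: x.
  apply/rowP => j; move/(congr1 (@complex.Im R)): (ES j).
  rewrite raddf_sum zxy !mxE /= => <-; apply: eq_bigr => i _.
  by rewrite zxy !mxE /= mulr0 add0r.
have := dotM x S y; rewrite Ssym xS yS dotDl -scaleNr !dotZl.
rewrite [dot x (_ + _)]dotC dotDl !dotZl [dot x y]dotC => e.
have {}e : b * (dot x x + dot y y) = 0 by lra.
have xy0 : 0 < dot x x + dot y y.
  rewrite lt_def addr_ge0 ?dot_ge0 // andbT paddr_eq0 ?dot_ge0 //.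
  apply: contra z0 => /andP[/eqP/dot_eq0 x0 /eqP/dot_eq0 y0].
  by apply/eqP/rowP => i; rewrite zxy x0 y0 !mxE.
have b0 : b = 0 by move/eqP: e; rewrite mulf_eq0 (gt_eqF xy0) orbF => /eqP.
rewrite b0 !scale0r ?subr0 ?addr0 in xS yS.
have [x0|x0] := eqVneq x 0; last by exists a, x.
exists a, y => //; apply: contraTneq xy0 => ->.
by rewrite x0 /dot !mul0mx mxE addr0 ltxx.
Qed.
End Euclid.

(** * Orthonormal frames, Schur's lemma and signature *)

Section Frames.
Variable R : realType.

Lemma bformE n (G : 'M[R]_n) x y : bform G x y = dot (x *m G) y.
Proof. by []. Qed.

Lemma bform_mx n (G : 'M[R]_n) x y : x *m G *m y^T = (bform G x y)%:M.
Proof. exact: mx11_scalar. Qed.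

Lemma frame_rank m n (G : 'M[R]_n) (C : 'M_(m, n)) :
  C *m G *m C^T = 1%:M -> \rank C = m.
Proof.
move=> CC; apply/eqP; rewrite eqn_leq rank_leq_row /=.
by rewrite -{1}(mxrank1 R m) -CC -mulmxA mxrankM_maxl.
Qed.

(** Gram-Schmidt: normalize one vector of [A] and recurse on its orthogonal in [A]. Positivity is
    asked on [A] only, because [G] will be indefinite. *)
Lemma posdef_frame k n p (G : 'M[R]_n) (A : 'M_(p, n)) :
  G^T = G -> \rank A = k ->
  (forall x : 'rV_n, (x <= A)%MS -> x != 0 -> 0 < bform G x x) ->
  exists2 C : 'M_(k, n), C *m G *m C^T = 1%:M & (C :=: A)%MS.
Proof.
move=> Gsym; elim: k p A => [|k IH] p A rA posA.
  exists 0; first by rewrite !mul0mx; apply/matrixP=> -[].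
  by apply/eqmxP; move/eqP: rA; rewrite mxrank_eq0 => /eqP ->; rewrite !sub0mx.
pose x := nz_row A; have xA : (x <= A)%MS by apply: nz_row_sub.
have x0 : x != 0 by rewrite nz_row_eq0 -mxrank_eq0 rA.
have px := posA x xA x0; pose c := Num.sqrt (bform G x x); pose e := c^-1 *: x.
have c0 : 0 < c by rewrite sqrtr_gt0.
have eA : (e <= A)%MS by rewrite scalemx_sub.
have ee : e *m G *m e^T = 1%:M.
  rewrite linearZ /= -scalemxAl -scalemxAr -scalemxAl scalerA bform_mx.
  rewrite scale_scalar_mx -[bform G x x]sqr_sqrtr ?ltW // -/c.
  by congr _%:M; field; rewrite gt_eqF.
pose A' := (A :&: kermx (G *m e^T))%MS.
have A'A : (A' <= A)%MS by apply: capmxSl.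
have rA' : \rank A' = k.
  have := mxrank_mul_ker A (G *m e^T); rewrite rA -/A'.
  suff -> : \rank (A *m (G *m e^T)) = 1%N by rewrite add1n => -[].
  apply/eqP; rewrite eqn_leq rank_leq_col lt0n mxrank_eq0.
  apply: contraTneq isT => A0; case/submxP: eA => w ew; move: ee.
  rewrite {1}ew -!mulmxA A0 mulmx0 => /matrixP/(_ 0 0)/eqP.
  by rewrite !mxE eq_sym oner_eq0.
have [|C' CC' CA'] := IH _ A' rA'.
  by move=> y yA; apply: posA; apply: submx_trans yA A'A.
have C'e : C' *m G *m e^T = 0.
  have : (C' <= kermx (G *m e^T))%MS by rewrite CA' capmxSr.
  by move/sub_kermxP; rewrite mulmxA.
have eC' : e *m G *m C'^T = 0.
  by apply: trmx_inj; rewrite !trmx_mul trmxK Gsym mulmxA C'e trmx0.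
have F : col_mx e C' *m G *m (col_mx e C')^T = 1%:M :> 'M_(1 + k).
  rewrite mul_col_mx tr_col_mx mul_col_row ee CC' C'e eC'.
  by rewrite -scalar_mx_block.
exists (col_mx e C') => //; apply/eqmxP.
have sub : (col_mx e C' <= A)%MS by rewrite col_mx_sub eA CA' A'A.
rewrite sub /= -(geq_leqif (mxrank_leqif_sup sub)) rA.
by rewrite (frame_rank F).
Qed.

Lemma dot_frame k p m (A : 'M[R]_(p, m)) : \rank A = k ->
  exists2 P : 'M_(k, m), P *m P^T = 1%:M & (P :=: A)%MS.
Proof.
move=> rA; have [||P PP PA] := @posdef_frame k _ _ 1%:M A _ rA.
- exact: trmx1.
- by move=> x _ x0; rewrite bformE mulmx1 dot_gt0.
by exists P => //; rewrite -PP mulmx1.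
Qed.

Lemma posdef_unit m (S : 'M[R]_m) :
  (forall x : 'rV_m, x *m S *m x^T = 0 -> x = 0) -> S \in unitmx.
Proof.
move=> h; rewrite -row_free_unit -kermx_eq0; apply/eqP/row_matrixP => i.
by rewrite row0; apply: h; rewrite -row_mul mulmx_ker row0 mul0mx.
Qed.

(** Irreducibility of R^m under right multiplication by the matrices in [P]; row spaces of square
    matrices exhaust the subspaces. *)
Definition irred m (P : 'M[R]_m -> Prop) : Prop :=
  (0 < m)%N /\ forall S : 'M[R]_m, S != 0 ->
    (forall X, P X -> (S *m X <= S)%MS) -> row_full S.

(** Take a matrix of maximal rank with row space inside [N]: a further vector of [N] would enlarge
    the rank. This lets irreducibility, phrased with matrices, be applied to linear conditions. *)
Lemma subspace_mx m (N : 'rV[R]_m -> Prop) : N 0 ->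
  (forall a x y, N x -> N y -> N (a *: x + y)) ->
  exists S : 'M_m, forall x : 'rV_m, (x <= S)%MS <-> N x.
Proof.
move=> N0 NL.
pose Q k := `[< exists2 S : 'M[R]_m, (forall x : 'rV_m, (x <= S)%MS -> N x)
                                     & \rank S = k >].
have exQ : exists k, Q k.
  exists 0; apply/asboolP; exists 0; last exact: mxrank0.
  by move=> x; rewrite submx0 => /eqP ->.
have boundQ k : Q k -> (k <= m)%N by case/asboolP => S _ <-; apply: rank_leq_row.
have [k /asboolP[S SN rS] maxk] := ex_maxnP exQ boundQ.
exists S => x; split=> [/SN //|Nx]; apply: contraT => xS.
have /maxk : Q (\rank (S + x)%MS).
  apply/asboolP; exists (S + x)%MS => // y /sub_addsmxP[[u1 u2] /= ->].
  rewrite addrC [u2]mx11_scalar mul_scalar_mx; apply: NL => //.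
  by apply: SN; apply: submxMl.
rewrite -rS leqNgt => /negP[]; apply: rank_ltmx.
by rewrite /ltmx addsmxSl addsmx_sub submx_refl.
Qed.

(** The working form of irreducibility: the solutions of a linear condition stable under [P] form an
    invariant subspace, which is everything once it is nonzero. *)
Lemma irred_all m (P : 'M[R]_m -> Prop) (N : 'rV[R]_m -> Prop) x :
  irred P -> (forall a x y, N x -> N y -> N (a *: x + y)) ->
  (forall X y, P X -> N y -> N (y *m X)) -> x != 0 -> N x -> forall y, N y.
Proof.
move=> [m0 irr] NL NP x0 Nx y.
have N0 : N 0 by have := NL (-1) x x Nx Nx; rewrite scaleN1r addNr.
have [S SN] := subspace_mx N0 NL; apply/SN/submx_full/irr => [|X PX].
  by apply: contraNneq x0 => S0; move/SN: Nx; rewrite S0 submx0.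
apply/row_subP => i; rewrite row_mul; apply/SN/NP => //.
exact/SN/row_sub.
Qed.

(** A symmetric [S] has a real eigenvector, and its eigenspace is invariant under whatever commutes
    with [S]. *)
Lemma Schur_sym m (P : 'M[R]_m -> Prop) (S : 'M_m) : irred P -> S^T = S ->
  (forall X, P X -> S *m X = X *m S) -> exists a, S = a%:M.
Proof.
move=> irr Ssym comm; have [a [x x0 xS]] := sym_eigenvector (proj1 irr) Ssym.
exists a; apply/row_matrixP => i; rewrite !rowE mul_mx_scalar.
move: (delta_mx 0 i : 'rV_m).
apply: (irred_all (N := fun y => y *m S = a *: y) irr _ _ x0 xS).
  move=> k y z yS zS.
  by rewrite mulmxDl -scalemxAl yS zS scalerDr !scalerA mulrC.
by move=> X y PX yS; rewrite -mulmxA -comm // mulmxA yS scalemxAl.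
Qed.

(* Orthogonal projection, for the semi-inner product [f], onto the image of [C]. *)
Lemma gram_project n m (C : 'M[R]_(m, n)) (f : 'rV[R]_n -> 'rV[R]_n -> R) :
  (forall k x y z, f (k *: x + y) z = k * f x z + f y z) ->
  (forall x y, f x y = f y x) ->
  (forall x : 'rV_m, f (x *m C) (x *m C) = 0 -> x = 0) ->
  forall a, exists w : 'rV_m, forall q : 'rV_m, f (a + w *m C) (q *m C) = 0.
Proof.
move=> fL fS fpos a.
have fD x y z : f (x + y) z = f x z + f y z by rewrite -{1}(scale1r x) fL mul1r.
have f0 z : f 0 z = 0 by apply: (addIr (f 0 z)); rewrite -fD addr0 add0r.
have fZ k x z : f (k *: x) z = k * f x z by rewrite -[k *: x]addr0 fL f0 addr0.
have fsum (x : 'rV_m) z : f (x *m C) z = \sum_i x 0 i * f (row i C) z.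
  rewrite mulmx_sum_row; elim/big_rec2: _ => // i p q _ <-.
  by rewrite fL.
pose S := \matrix_(i, j) f (row i C) (row j C).
have SE (x y : 'rV_m) : x *m S *m y^T = (f (x *m C) (y *m C))%:M.
  rewrite [LHS]mx11_scalar fS fsum mxE; congr _%:M; apply: eq_bigr => j _.
  rewrite mxE [y^T _ _]mxE mulrC fS fsum; congr (_ * _).
  by apply: eq_bigr => i _; rewrite mxE.
have Su : S \in unitmx.
  by apply: posdef_unit => x; rewrite SE => /matrixP/(_ 0 0); rewrite !mxE => /fpos.
pose l : 'rV_m := \row_j f a (row j C).
exists (- (l *m invmx S)) => q.
have := SE (- (l *m invmx S)) q; rewrite mulNmx mulmxKV // mulNmx => /matrixP/(_ 0 0).
rewrite !mxE eqxx mulr1n fD => <-; rewrite fS fsum; apply/eqP; rewrite subr_eq0; apply/eqP.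
by apply: eq_bigr => j _; rewrite !mxE mulrC fS.
Qed.

(** The tensor sum_k e_k (x) e_k is invariant under skew matrices, so moving [X] to the other slot
    costs only a sign. *)
Lemma skew_contract m (U : lmodType R) (B : 'rV[R]_m -> 'rV[R]_m -> U) (X : 'M_m) :
  (forall k x y z, B (k *: x + y) z = k *: B x z + B y z) ->
  (forall k x y z, B z (k *: x + y) = k *: B z x + B z y) ->
  X^T = - X ->
  \sum_k B (delta_mx 0 k *m X) (delta_mx 0 k) =
  - \sum_k B (delta_mx 0 k) (delta_mx 0 k *m X).
Proof.
move=> BL BR Xs.
have B0l z : B 0 z = 0.
  by have := BL (-1) z z z; rewrite scaleN1r addNr scaleN1r addNr.
have B0r z : B z 0 = 0.
  by have := BR (-1) z z z; rewrite scaleN1r addNr scaleN1r addNr.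
have El (x z : 'rV_m) : B x z = \sum_i x 0 i *: B (delta_mx 0 i) z.
  rewrite {1}(row_sum_delta x).
  by elim/big_rec2: _ => [|i p q _ <-]; rewrite ?B0l ?BL.
have Er (x z : 'rV_m) : B z x = \sum_i x 0 i *: B z (delta_mx 0 i).
  rewrite {1}(row_sum_delta x).
  by elim/big_rec2: _ => [|i p q _ <-]; rewrite ?B0r ?BR.
under eq_bigr do rewrite El; rewrite exchange_big -sumrN; apply: eq_bigr => i _.
rewrite Er -sumrN; apply: eq_bigr => k _; rewrite -scaleNr -!rowE !mxE.
by congr (_ *: _); have /matrixP/(_ k i) := Xs; rewrite !mxE => ->; rewrite opprK.
Qed.

(** A real eigenvector is split off and [S] is compressed to its orthogonal; the off-diagonal blocks
    vanish because [S] is symmetric. *)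
Lemma sym_diag m (S : 'M[R]_m) : S^T = S ->
  exists2 P : 'M_m, P *m P^T = 1%:M & exists d, P *m S *m P^T = diag_mx d.
Proof.
elim: m S => [|m IH] S Ssym.
  by exists 1%:M; rewrite ?trmx1 ?mulmx1 //; exists 0; apply/matrixP => -[].
have [a [x x0 xS]] := sym_eigenvector (ltn0Sn m) Ssym.
have rx : \rank x = 1%N by rewrite rank_rV x0.
have [e ee ex] := dot_frame rx.
have eS : e *m S = a *: e.
  have : (e <= x)%MS by rewrite ex.
  by case/submxP => w ->; rewrite -mulmxA xS scalemxAr.
have rk : \rank (kermx x^T) = m by rewrite mxrank_ker mxrank_tr rx subn1.
have [Q QQ Qk] := dot_frame rk.
have Qe : Q *m e^T = 0.
  have /submxP[w ->] : (e <= x)%MS by rewrite ex.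
  rewrite trmx_mul mulmxA; suff /sub_kermxP -> : (Q <= kermx x^T)%MS.
    by rewrite mul0mx.
  by rewrite Qk.
have eQ : e *m Q^T = 0 by rewrite -[LHS]trmxK trmx_mul trmxK Qe trmx0.
have [|P PP [d Pd]] := IH (Q *m S *m Q^T).
  by rewrite !trmx_mul trmxK Ssym mulmxA.
have UU : col_mx e (P *m Q) *m (col_mx e (P *m Q))^T = 1%:M :> 'M_(1 + m).
  rewrite tr_col_mx mul_col_row trmx_mul -(mulmxA P Q e^T) Qe mulmx0.
  rewrite (mulmxA e) eQ mul0mx ee (mulmxA (P *m Q)) -(mulmxA P Q) QQ mulmx1 PP.
  by rewrite -scalar_mx_block.
suff USU : col_mx e (P *m Q) *m S *m (col_mx e (P *m Q))^T =
    diag_mx (row_mx a%:M d) :> 'M_(1 + m).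
  by exists (col_mx e (P *m Q)) => //; exists (row_mx a%:M d).
rewrite diag_mx_row mul_col_mx tr_col_mx mul_col_row eS trmx_mul.
rewrite -!scalemxAl ee (mulmxA e) eQ mul0mx scaler0.
have SeT : S *m e^T = a *: e^T by rewrite -{1}Ssym -trmx_mul eS linearZ.
rewrite -(mulmxA _ S e^T) SeT -scalemxAr -(mulmxA P Q) Qe mulmx0 scaler0.
have -> : P *m Q *m S *m (Q^T *m P^T) = diag_mx d by rewrite -Pd !mulmxA.
congr block_mx; apply/matrixP => i j; rewrite !ord1 !mxE eqxx /=.
by rewrite mulr1.
Qed.

(** The eigenvectors with positive eigenvalue span [B]. No eigenvalue is zero since [G] is
    invertible, so all but [r] of them are positive. *)
Lemma sym_pos_subspace n (G : 'M[R]_n) r :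
  G^T = G -> G \in unitmx -> index_of G r ->
  exists2 B : 'M_n, (n <= \rank B + r)%N &
    forall x : 'rV_n, (x <= B)%MS -> x != 0 -> 0 < bform G x x.
Proof.
move=> Gsym Gunit [s [cs cnt]]; have [P PP [d Pd]] := sym_diag Gsym.
have Punit : P \in unitmx by case/mulmx1_unit: PP.
have PtP : P^T *m P = 1%:M by apply: mulmx1C.
have Gd : G = P^T *m diag_mx d *m P by rewrite -Pd -!mulmxA PtP mulmx1 !mulmxA PtP mul1mx.
have d0 i : d 0 i != 0.
  have: diag_mx d \in unitmx by rewrite -Pd !unitmx_mul unitmx_tr Punit Gunit.
  rewrite unitmxE det_diag unitfE => /prodf_neq0; exact.
have cd : char_poly G = \prod_(i < n) ('X - (d 0 i)%:P).
  have -> : char_poly G = char_poly (diag_mx d).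
    rewrite /char_poly; set Dx := char_poly_mx (diag_mx d).
    have -> : char_poly_mx G = map_mx polyC P^T *m Dx *m map_mx polyC P.
      rewrite /char_poly_mx mulmxBr mulmxBl Gd !map_mxM; congr (_ - _).
      rewrite scalar_mxC -mulmxA -map_mxM PtP map_mx1 mulmx1 //.
    rewrite !det_mulmx mulrAC -det_mulmx -map_mxM PtP map_mx1 det1 mul1r //.
  rewrite char_poly_trig ?diag_mx_is_trig //.
  by apply: eq_bigr => i _; rewrite mxE eqxx mulr1n.
pose sd := [seq d 0 i | i <- enum 'I_n].
(* The list [s] behind the index and the diagonal [d] record the same root multiplicities of
   [char_poly G], hence agree up to order. *)
have /seq.permP eqs : perm_eq s sd.
  apply/allP => a _ /=; rewrite -!mu_prod_XsubC.
  by rewrite -cs cd big_map big_enum.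
have cneg : #|[set i | d 0 i < 0]| = r.
  rewrite -cnt eqs count_map -sum1_card -sum1_count big_enum_cond /=.
  by apply: eq_bigl => i; rewrite inE.
pose A := [set i | 0 < d 0 i].
have cpos : #|A| = (n - r)%N.
  have : ~: A = [set i | d 0 i < 0].
    by apply/setP => i; rewrite !inE -leNgt le_eqVlt (negPf (d0 i)).
  by move: (cardsC A) => + eqAC; rewrite eqAC cneg card_ord => e; rewrite -(addnK r #|A|) e.
pose B := \matrix_(k < #|A|) row (enum_val k) P.
have BGB : B *m G *m B^T = diag_mx (\row_k d 0 (enum_val k)).
  have BE : B = rowsub enum_val P by apply/row_matrixP => k; rewrite rowK row_rowsub.
  apply/matrixP => i j; rewrite mxE [RHS]mxE mxE -(inj_eq enum_val_inj).
  transitivity ((P *m G *m P^T) (enum_val i) (enum_val j)); last first.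
    by rewrite Pd mxE.
  rewrite [RHS]mxE; apply: eq_bigr => k _; congr (_ * _); rewrite !mxE //.
  by apply: eq_bigr => l _; rewrite !mxE.
have posB (c : 'rV_#|A|) : c != 0 -> 0 < bform G (c *m B) (c *m B).
  move=> c0; rewrite /bform trmx_mul mulmxA -(mulmxA c) -(mulmxA c) -[_ *m B^T]mulmxA.
  rewrite (mulmxA B) BGB mul_mx_diag mxE lt_def sumr_ge0 ?andbT.
    apply: contra c0; rewrite psumr_eq0 => [/allP h|i _]; last first.
      rewrite !mxE mulrAC -expr2 mulr_ge0 ?sqr_ge0 //.
      by have:= enum_valP i; rewrite inE => /ltW.
    apply/eqP/rowP => i; have := h i (mem_index_enum i); rewrite !mxE /=.
    by rewrite mulf_eq0 mulf_eq0 (negPf (d0 _)) orbF orbb => /eqP.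
  move=> i _; rewrite !mxE mulrAC -expr2 mulr_ge0 ?sqr_ge0 //.
  by have:= enum_valP i; rewrite inE => /ltW.
have Bfree : row_free B.
  rewrite -kermx_eq0; apply/eqP/row_matrixP => i; rewrite row0; apply/eqP.
  apply: contraTT isT => /posB; rewrite -row_mul mulmx_ker row0 /bform !mul0mx.
  by rewrite mxE ltxx.
exists <<B>>%MS.
  by rewrite mxrank_gen (eqP Bfree) cpos addnC -leq_subLR.
move=> x; rewrite genmxE => /submxP[c ->] cB; apply: posB.
by apply: contraNneq cB => ->; rewrite mul0mx.
Qed.
End Frames.

Fact frame_key : unit. Proof. exact: tt. Qed.

(** * The alternating four-form and the operators ad(a,b) *)

Section Metric3Lie.
Variables (R : realType) (n : nat) (G : 'M[R]_n).
Local Notation V := 'rV[R]_n.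

Lemma bformDl x y z : bform G (x + y) z = bform G x z + bform G y z.
Proof. by rewrite /bform !mulmxDl mxE. Qed.
Lemma bformDr x y z : bform G x (y + z) = bform G x y + bform G x z.
Proof. by rewrite /bform linearD mulmxDr mxE. Qed.
Lemma bformZl a x y : bform G (a *: x) y = a * bform G x y.
Proof. by rewrite /bform -!scalemxAl mxE. Qed.
Lemma bformZr a x y : bform G x (a *: y) = a * bform G x y.
Proof. by rewrite /bform linearZ -scalemxAr mxE. Qed.
Lemma bformNl x y : bform G (- x) y = - bform G x y.
Proof. by rewrite -scaleN1r bformZl mulN1r. Qed.
Lemma bformNr x y : bform G x (- y) = - bform G x y.
Proof. by rewrite -scaleN1r bformZr mulN1r. Qed.
Lemma bformBl x y z : bform G (x - y) z = bform G x z - bform G y z.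
Proof. by rewrite bformDl bformNl. Qed.
Lemma bformBr x y z : bform G x (y - z) = bform G x y - bform G x z.
Proof. by rewrite bformDr bformNr. Qed.
Lemma bform0l y : bform G 0 y = 0.
Proof. by rewrite -(scale0r 0) bformZl mul0r. Qed.
Lemma bform0r x : bform G x 0 = 0.
Proof. by rewrite -(scale0r 0) bformZr mul0r. Qed.
Lemma bform_suml I s (P : pred I) F y :
  bform G (\sum_(i <- s | P i) F i) y = \sum_(i <- s | P i) bform G (F i) y.
Proof. by elim/big_rec2: _ => [|i a b _ <-]; rewrite ?bform0l ?bformDl. Qed.
Lemma bform_sumr I s (P : pred I) F x :
  bform G x (\sum_(i <- s | P i) F i) = \sum_(i <- s | P i) bform G x (F i).
Proof. by elim/big_rec2: _ => [|i a b _ <-]; rewrite ?bform0r ?bformDr. Qed.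

Lemma bform_eq0 p (A : 'M_(p, n)) x :
  (forall y : V, (y <= A)%MS -> bform G x y = 0) <-> x *m G *m A^T = 0.
Proof.
split=> [h|h y /submxP[w ->]]; last first.
  by rewrite /bform trmx_mul mulmxA h mul0mx mxE.
apply/rowP => j; rewrite [RHS]mxE -(h _ (row_sub j A)) /bform !mxE.
by apply: eq_bigr => k _; rewrite !mxE.
Qed.

Variable (br : V -> V -> V -> V).
Hypotheses (HL : is_3Lie br) (HM : is_metric3 G br).

Lemma G_sym : G^T = G. Proof. by case: HM. Qed.
Lemma G_unit : G \in unitmx. Proof. by case: HM. Qed.

Lemma bformC x y : bform G x y = bform G y x.
Proof. by rewrite !bformE dotM G_sym dotC. Qed.

Lemma bform_nondeg x : (forall y, bform G x y = 0) -> x = 0.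
Proof.
move=> h; have : x *m G *m 1%:M^T = 0 by apply/bform_eq0.
by rewrite trmx1 mulmx1 => /(canRL (mulmxK G_unit)); rewrite mul0mx.
Qed.

Lemma brDl x x' y z : br (x + x') y z = br x y z + br x' y z.
Proof. by case: HL => [[h _] _ _]; rewrite -(scale1r x) h !scale1r. Qed.
Lemma brDr x y z z' : br x y (z + z') = br x y z + br x y z'.
Proof. by case: HL => [[_ [_ h]] _ _]; rewrite -(scale1r z) h !scale1r. Qed.
Lemma brDm x y y' z : br x (y + y') z = br x y z + br x y' z.
Proof. by case: HL => [[_ [h _]] _ _]; rewrite -(scale1r y) h !scale1r. Qed.
Lemma br0l y z : br 0 y z = 0.
Proof. by apply: (addIr (br 0 y z)); rewrite -brDl addr0 add0r. Qed.
Lemma br0m x z : br x 0 z = 0.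
Proof. by apply: (addIr (br x 0 z)); rewrite -brDm addr0 add0r. Qed.
Lemma br0r x y : br x y 0 = 0.
Proof. by apply: (addIr (br x y 0)); rewrite -brDr addr0 add0r. Qed.
Lemma brZl a x y z : br (a *: x) y z = a *: br x y z.
Proof. by case: HL => [[h _] _ _]; rewrite -[a *: x]addr0 h br0l addr0. Qed.
Lemma brZm a x y z : br x (a *: y) z = a *: br x y z.
Proof. by case: HL => [[_ [h _]] _ _]; rewrite -[a *: y]addr0 h br0m addr0. Qed.
Lemma brZr a x y z : br x y (a *: z) = a *: br x y z.
Proof. by case: HL => [[_ [_ h]] _ _]; rewrite -[a *: z]addr0 h br0r addr0. Qed.

Lemma br12 x y z : br x y z = - br y x z.
Proof. by case: HL => _ h _; case: (h x y z). Qed.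
Lemma br23 x y z : br x y z = - br x z y.
Proof. by case: HL => _ h _; case: (h x y z). Qed.
Lemma eq_oppr0 (U : lmodType R) (x : U) : x = - x -> x = 0.
Proof.
move/eqP; rewrite -addr_eq0 -mulr2n -scaler_nat scaler_eq0 pnatr_eq0.
by move/eqP.
Qed.
Lemma br_alt x y : br x x y = 0.
Proof. exact: eq_oppr0 (br12 x x y). Qed.
Lemma br_rot x y z : br x y z = br y z x.
Proof. by rewrite br12 br23 opprK. Qed.
Lemma br13 x y z : br x y z = - br z y x.
Proof. by rewrite br_rot br12. Qed.
Lemma FI x y z s t :
  br x y (br z s t) = br (br x y z) s t + br z (br x y s) t + br z s (br x y t).
Proof. by case: HL. Qed.

(** Together with [br12] and [br23] this makes <[a,b,c],t> an alternating four-form. *)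
Lemma w34 a b c t : bform G (br a b c) t = - bform G (br a b t) c.
Proof.
by case: HM => _ _ h; rewrite (bformC (br a b t)); apply/eqP; rewrite -addr_eq0 h.
Qed.

Lemma br_suml I s (P : pred I) F y z :
  br (\sum_(i <- s | P i) F i) y z = \sum_(i <- s | P i) br (F i) y z.
Proof. by elim/big_rec2: _ => [|i a b _ <-]; rewrite ?br0l ?brDl. Qed.
Lemma br_summ I s (P : pred I) F x z :
  br x (\sum_(i <- s | P i) F i) z = \sum_(i <- s | P i) br x (F i) z.
Proof. by elim/big_rec2: _ => [|i a b _ <-]; rewrite ?br0m ?brDm. Qed.
Lemma br_sumr I s (P : pred I) F x y :
  br x y (\sum_(i <- s | P i) F i) = \sum_(i <- s | P i) br x y (F i).
Proof. by elim/big_rec2: _ => [|i a b _ <-]; rewrite ?br0r ?brDr. Qed.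

Definition ad (a b : V) : 'M[R]_n := \matrix_i br a b (delta_mx 0 i).

Lemma mul_ad x a b : x *m ad a b = br a b x.
Proof.
rewrite {2}(row_sum_delta x) br_sumr mulmx_sum_row.
by apply: eq_bigr => i _; rewrite rowK brZr.
Qed.

Lemma ad_eq a b M : (forall x, br a b x = x *m M) -> ad a b = M.
Proof. by move=> h; apply/row_matrixP => i; rewrite rowK h -rowE. Qed.

Lemma adDl a a' b : ad (a + a') b = ad a b + ad a' b.
Proof. by apply: ad_eq => x; rewrite mulmxDr !mul_ad brDl. Qed.
Lemma adZl k a b : ad (k *: a) b = k *: ad a b.
Proof. by apply: ad_eq => x; rewrite -scalemxAr mul_ad brZl. Qed.
Lemma adC a b : ad a b = - ad b a.
Proof. by apply: ad_eq => x; rewrite mulmxN mul_ad br12. Qed.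

Lemma ad_skew a b : (ad a b *m G)^T = - (ad a b *m G).
Proof.
apply/matrixP => i j; rewrite !mxE.
transitivity (bform G (br a b (delta_mx 0 j)) (delta_mx 0 i)).
  by rewrite -mul_ad /bform -!mulmxA -rowE mulmxA trmx_delta -colE !mxE.
rewrite w34; congr (- _).
by rewrite -mul_ad /bform -!mulmxA -rowE mulmxA trmx_delta -colE !mxE.
Qed.

Lemma adG_tr p q a b (A : 'M_(p, n)) (B : 'M_(q, n)) :
  A *m ad a b *m G *m B^T = - (B *m ad a b *m G *m A^T)^T.
Proof.
rewrite -(mulmxA B) trmx_mul trmxK trmx_mul ad_skew mulNmx mulmxN opprK.
by rewrite !mulmxA.
Qed.

(** On row vectors the left factor acts first, so the left side is the usual commutator of ad(a,b)
    with ad(c,d). *)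
Lemma ad_FI a b c d :
  ad c d *m ad a b - ad a b *m ad c d = ad (br a b c) d + ad c (br a b d).
Proof.
apply/row_matrixP => i; rewrite !rowE mulmxBr mulmxDr !mulmxA !mul_ad.
by rewrite FI addrK.
Qed.

(** * The orthogonal of the centre and invariant frames *)

Variable Z : 'M[R]_n.
Hypothesis HZ : forall z : V, (z <= Z)%MS <-> central br z.

Definition Zp (c : V) : Prop := c *m G *m Z^T = 0.

(** A central argument annihilates the four-form. *)
Lemma Zp_br a b c : Zp (br a b c).
Proof.
by apply/bform_eq0 => z /HZ zc; rewrite w34 br_rot br_rot zc bform0l oppr0.
Qed.

Lemma ZpD c d : Zp c -> Zp d -> Zp (c + d).
Proof. by rewrite /Zp !mulmxDl => -> ->; rewrite addr0. Qed.
Lemma ZpZ k c : Zp c -> Zp (k *: c).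
Proof. by rewrite /Zp -!scalemxAl => ->; rewrite scaler0. Qed.
Lemma ZpN c : Zp c -> Zp (- c).
Proof. by rewrite -scaleN1r; apply: ZpZ. Qed.
Lemma Zp_sum I s (P : pred I) F : (forall i, P i -> Zp (F i)) ->
  Zp (\sum_(i <- s | P i) F i).
Proof. by move=> h; elim/big_rec: _ => [|i x /h]; [rewrite /Zp !mul0mx|apply: ZpD]. Qed.

(* The span of a frame [C] is, modulo the centre, an ideal: an orthonormal
   family in the orthogonal of the centre whose image under every [ad a b]
   is orthogonal to the orthogonal complement of [C] in that space. *)
Record inv_frame m (C : 'M[R]_(m, n)) : Prop := InvFrame {
  frameCC : C *m G *m C^T = 1%:M;
  frameCZ : C *m G *m Z^T = 0;
  frame_inv : forall a b c, Zp c -> C *m G *m c^T = 0 ->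
    C *m ad a b *m G *m c^T = 0 }.

(* [D C a b] is the matrix, in the frame [C], of the skew endomorphism [ad a b]
   of Z^perp / Z; [pr C] is the orthogonal projection onto the frame. *)
Definition D m (C : 'M[R]_(m, n)) a b : 'M_m :=
  locked_with frame_key (C *m ad a b *m G *m C^T).
Definition pr m (C : 'M[R]_(m, n)) (c : V) : 'rV_m :=
  locked_with frame_key (c *m G *m C^T).

Lemma DE m (C : 'M[R]_(m, n)) a b : D C a b = C *m ad a b *m G *m C^T.
Proof. by rewrite /D unlock. Qed.
Lemma prE m (C : 'M[R]_(m, n)) c : pr C c = c *m G *m C^T.
Proof. by rewrite /pr unlock. Qed.

Section Frame.
Variables (m : nat) (C : 'M[R]_(m, n)) (HC : inv_frame C).
Implicit Types x y : 'rV[R]_m.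

Lemma frame_perpC p (c : 'M_(p, n)) : c *m G *m C^T = 0 <-> C *m G *m c^T = 0.
Proof.
by split=> h; apply: trmx_inj; rewrite !trmx_mul trmxK G_sym mulmxA h trmx0.
Qed.

Lemma prD c d : pr C (c + d) = pr C c + pr C d.
Proof. by rewrite !prE !mulmxDl. Qed.
Lemma prZ k c : pr C (k *: c) = k *: pr C c.
Proof. by rewrite !prE -!scalemxAl. Qed.
Lemma prN c : pr C (- c) = - pr C c.
Proof. by rewrite -scaleN1r prZ scaleN1r. Qed.

Lemma frameK x : pr C (x *m C) = x.
Proof. by rewrite !prE -!mulmxA (mulmxA C) (frameCC HC) mulmx1. Qed.

Lemma Zp_frame x : Zp (x *m C).
Proof. by rewrite /Zp -!mulmxA (mulmxA C) (frameCZ HC) mulmx0. Qed.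

Lemma Zp_res c : Zp c -> Zp (c - pr C c *m C).
Proof. by move=> Zc; apply: ZpD => //; apply/ZpN/Zp_frame. Qed.

Lemma pr_res c : pr C (c - pr C c *m C) = 0.
Proof. by rewrite prD prN frameK subrr. Qed.

Lemma D_E x a b : x *m D C a b = pr C (br a b (x *m C)).
Proof. by rewrite DE prE -mul_ad !mulmxA. Qed.

Lemma D_Dl a a' b : D C (a + a') b = D C a b + D C a' b.
Proof. by rewrite !DE adDl mulmxDr !mulmxDl. Qed.
Lemma D_Zl k a b : D C (k *: a) b = k *: D C a b.
Proof. by rewrite !DE adZl -scalemxAr -!scalemxAl. Qed.
Lemma D_C a b : D C a b = - D C b a.
Proof. by rewrite !DE adC mulmxN !mulNmx. Qed.
Lemma D_Dr a b b' : D C a (b + b') = D C a b + D C a b'.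
Proof. by rewrite D_C D_Dl opprD -!D_C. Qed.
Lemma D_Zr k a b : D C a (k *: b) = k *: D C a b.
Proof. by rewrite D_C D_Zl -scalerN -D_C. Qed.
Lemma D_suml I s (P : pred I) F b :
  D C (\sum_(i <- s | P i) F i) b = \sum_(i <- s | P i) D C (F i) b.
Proof.
elim/big_rec2: _ => [|i a c _ <-]; rewrite ?D_Dl //.
by rewrite -(scale0r 0) D_Zl scale0r.
Qed.
Lemma D_sumr I s (P : pred I) F b :
  D C b (\sum_(i <- s | P i) F i) = \sum_(i <- s | P i) D C b (F i).
Proof. by rewrite D_C D_suml -sumrN; apply: eq_bigr => i _; rewrite -D_C. Qed.

Lemma D_skew a b : (D C a b)^T = - D C a b.
Proof. by rewrite [in RHS]DE adG_tr opprK DE. Qed.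

Lemma D_cyc x y a : y *m D C a (x *m C) = - (x *m D C a (y *m C)).
Proof. by rewrite !D_E -prN -br23. Qed.

(** The bracket vanishes exactly, not just modulo Z: its pairing with any t is, up to sign,
    <[t,b,xC],c>, which [frame_inv] kills. This is what decouples different summands. *)
Lemma br_perp c b x : Zp c -> pr C c = 0 -> br c b (x *m C) = 0.
Proof.
rewrite prE => Zc /frame_perpC pc; apply: bform_nondeg => t.
rewrite br13 bformNl w34 opprK br13 bformNl /bform -mul_ad.
by rewrite -3!(mulmxA x) (frame_inv HC) // mulmx0 mxE oppr0.
Qed.

Lemma D_perp c b : Zp c -> pr C c = 0 -> D C c b = 0.
Proof.
move=> Zc pc; apply/row_matrixP => i.
by rewrite rowE D_E br_perp // row0 prE !mul0mx.
Qed.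

Lemma D_pr c b : Zp c -> D C c b = D C (pr C c *m C) b.
Proof.
move=> Zc; rewrite -{1}(subrK (pr C c *m C) c) D_Dl D_perp ?add0r ?pr_res //.
exact: Zp_res.
Qed.

Lemma pr_br c a b : Zp c -> pr C (br a b c) = pr C c *m D C a b.
Proof.
move=> Zc; rewrite D_E -{1}(subrK (pr C c *m C) c) brDr prD.
rewrite [X in X + _](_ : _ = 0) ?add0r //.
rewrite [pr C (br _ _ _)]prE -mul_ad; apply: trmx_inj; apply: oppr_inj.
rewrite -adG_tr trmx0 oppr0; apply: (frame_inv HC); first exact: Zp_res.
by apply/frame_perpC; rewrite -prE pr_res.
Qed.

(** The fundamental identity descends to a frame: inner brackets lie in Z^perp, so by [D_pr] only
    their components in the frame count. *)
Lemma D_FI a b c d : D C c d *m D C a b - D C a b *m D C c d =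
  D C (pr C (br a b c) *m C) d + D C c (pr C (br a b d) *m C).
Proof.
rewrite [D C c (_ *m _)]D_C -!D_pr; try exact: Zp_br; rewrite -[in RHS]D_C.
suff E e f g h : D C e f *m D C g h = C *m (ad e f *m ad g h) *m G *m C^T.
  by rewrite !E -!mulmxBl -mulmxBr ad_FI mulmxDr !mulmxDl !DE.
apply/row_matrixP => i; rewrite !rowE (mulmxA _ (D C e f)) (D_E _ e f) -pr_br.
  by rewrite !prE -!mul_ad !mulmxA.
exact: Zp_br.
Qed.

(** * Irreducible frames and the Hilbert-Schmidt form *)

Definition D_op (X : 'M[R]_m) : Prop := exists a b, X = D C a b.

Hypothesis Hirr : irred D_op.

Variables (r : nat) (u : 'I_r -> V).
Hypothesis Hu : forall a : V, exists c : 'I_r -> R, Zp (a - \sum_i c i *: u i).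

Notation iota x := (x *m C).
Notation K a b c := (pr C (br a b c)).

Definition shift (w : 'I_r -> 'rV[R]_m) i : V := u i + iota (w i).

(** Only brackets of frame vectors among themselves may survive modulo Z. *)
Definition decoupled (u' : 'I_r -> V) : Prop :=
  [/\ forall i x, D C (u' i) (iota x) = 0,
      forall i j, D C (u' i) (u' j) = 0 &
      forall i j k, K (u' i) (u' j) (u' k) = 0].

Lemma D_cyc0 x a : x *m D C a (iota x) = 0.
Proof.
exact: eq_oppr0 (D_cyc x x a).
Qed.

Lemma D_iotaL a k x y :
  D C a (iota (k *: x + y)) = k *: D C a (iota x) + D C a (iota y).
Proof. by rewrite mulmxDl -scalemxAl D_Dr D_Zr. Qed.

Lemma D_iotaN a x : D C a (iota (- x)) = - D C a (iota x).
Proof. by rewrite mulNmx -scaleN1r D_Zr scaleN1r. Qed.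

Lemma D_0r a : D C a 0 = 0.
Proof. by rewrite -(scale0r 0) D_Zr scale0r. Qed.

Lemma D_iota_eq0 a : (forall k, D C a (iota (delta_mx 0 k)) = 0) ->
  forall x, D C a (iota x) = 0.
Proof.
move=> h x; rewrite (row_sum_delta x) mulmx_suml D_sumr big1 // => i _.
by rewrite -scalemxAl D_Zr h scaler0.
Qed.

(** The Hilbert-Schmidt product of the maps x |-> ad(a,x) and x |-> ad(b,x) on the frame: positive
    semidefinite, with null vectors those whose map is zero. *)
Definition trace_form (a b : V) : R :=
  \sum_k \tr (D C a (iota (delta_mx 0 k)) *m (D C b (iota (delta_mx 0 k)))^T).

Lemma trace_form_linear k a a' b : trace_form (k *: a + a') b = k * trace_form a b + trace_form a' b.
Proof.
rewrite /trace_form mulr_sumr -big_split /=; apply: eq_bigr => i _.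
by rewrite D_Dl D_Zl mulmxDl -scalemxAl linearD linearZ.
Qed.

Lemma mxtrace_mulTC p q (A B : 'M[R]_(p, q)) : \tr (A *m B^T) = \tr (B *m A^T).
Proof. by rewrite -mxtrace_tr trmx_mul trmxK. Qed.

Lemma trace_form_sym a b : trace_form a b = trace_form b a.
Proof. by apply: eq_bigr => i _; rewrite mxtrace_mulTC. Qed.

Lemma trace_form_eq0 a : trace_form a a = 0 -> forall x, D C a (iota x) = 0.
Proof.
move/psumr_eq0P => h; apply: D_iota_eq0 => k.
by apply: mxtrace_mulT_eq0; apply: h => // i _; apply: mxtrace_mulT_ge0.
Qed.

(** The commutator with a skew [X] is itself skew for the Hilbert-Schmidt product. *)
Lemma mxtrace_commT (T P X : 'M[R]_m) : X^T = - X ->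
  \tr ((T *m X - X *m T) *m P^T) = - \tr (T *m (P *m X - X *m P)^T).
Proof.
move=> Xs; have -> : (P *m X - X *m P)^T = P^T *m X - X *m P^T.
  by rewrite linearB /= !trmx_mul Xs mulNmx mulmxN opprK addrC.
rewrite mulmxBl mulmxBr !raddfB /= -!mulmxA (mxtrace_mulC X) -!mulmxA.
by rewrite opprK addrC.
Qed.

(** * Summands with a nonzero bracket of three frame vectors *)

(* In both projection arguments below, T := ad(a) is corrected by an inner term so
   that it becomes orthogonal to the image of Phi : w |-> ad(w). A skew operator X
   maps T to Phi(p) for some p and preserves the image of Phi, hence
   |Phi(p)|^2 = <X T, Phi(p)> = - <T, X Phi(p)> = 0. *)
Section TernaryBracket.
Hypothesis HA : exists x y, D C (iota x) (iota y) != 0.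

(** The z with this property form an invariant subspace, which [HA] prevents from being
    everything. *)
Lemma ternary_faithful z : (forall y, D C (iota z) (iota y) = 0) -> z = 0.
Proof.
move=> hz; apply/eqP; apply: contraT => z0; case: HA => x [y /negP[]]; apply/eqP.
move: x y; apply: (irred_all (N := fun x => forall y, D C (iota x) (iota y) = 0)
  Hirr _ _ z0 hz).
  move=> a x x' hx hx' y.
  by rewrite mulmxDl -scalemxAl D_Dl D_Zl hx hx' scaler0 addr0.
move=> X x [a [b ->]] hx y.
have := D_FI a b (iota x) (iota y); rewrite !hx mulmx0 mul0mx subrr addr0.
by rewrite -D_E => <-.
Qed.

Lemma ternary_shift1 a : exists w, forall x, D C (a + iota w) (iota x) = 0.
Proof.
have pos x : trace_form (iota x) (iota x) = 0 -> x = 0.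
  by move/trace_form_eq0; apply: ternary_faithful.
have [w hw] := gram_project trace_form_linear trace_form_sym pos a.
exists w; set a' := a + _ in hw *.
suff h x y : K (iota x) (iota y) a' = 0.
  move=> x; apply/row_matrixP => i; rewrite rowE row0 D_E.
  by rewrite br_rot h.
set p := K _ _ _; pose X := D C (iota x) (iota y).
have Xs : X^T = - X by apply: D_skew.
pose T z := D C a' (iota z); pose P z := D C (iota p) (iota z).
(* [X] acts on a map z |-> T z by commutator on the values and by itself on the argument. On z |->
   ad(c,z) the result is z |-> ad([x,y,c],z). *)
have FIX c z : D C c (iota z) *m X - X *m D C c (iota z) - D C c (iota (z *m X)) =
    D C (iota (K (iota x) (iota y) c)) (iota z).
  by rewrite D_FI -D_E addrK.
have TP z : P z = T z *m X - X *m T z - T (z *m X) by rewrite FIX.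
have PP z : P z *m X - X *m P z - P (z *m X) = D C (iota (p *m X)) (iota z).
  by rewrite FIX D_E.
apply: ternary_faithful; apply: trace_form_eq0.
(* Skewness of this action for [trace_form]: the values are handled by [mxtrace_commT], the
   arguments by [skew_contract]. The new term is inner, so [hw] annihilates it. *)
transitivity (- trace_form a' (iota (p *m X))); last by rewrite hw oppr0.
have E1 k : \tr (D C (iota p) (iota k) *m (D C (iota p) (iota k))^T) =
    - \tr (T k *m (P k *m X - X *m P k)^T) - \tr (T (k *m X) *m (P k)^T).
  by rewrite -/(P k) {1}TP mulmxBl linearB /= mxtrace_commT.
have E2 k : \tr (D C a' (iota k) *m (D C (iota (p *m X)) (iota k))^T) =
    \tr (T k *m (P k *m X - X *m P k)^T) - \tr (T k *m (P (k *m X))^T).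
  by rewrite -/(T k) -PP [X in _ *m X]linearB mulmxBr linearB.
rewrite /trace_form (eq_bigr _ (fun k _ => E1 _)) (eq_bigr _ (fun k _ => E2 _)) !sumrB.
rewrite (skew_contract (U := R^o) (B := fun z z' => \tr (T z *m (P z')^T))) //.
- by rewrite sumrN opprK opprB addrC.
- by move=> k z z' z''; rewrite /T D_iotaL mulmxDl -scalemxAl linearD linearZ.
- move=> k z z' z''; rewrite /P D_iotaL linearD linearZ mulmxDr -scalemxAr.
  by rewrite linearD linearZ.
Qed.

(** Once the operators ad(u_i,x) vanish, the fundamental identity leaves only ad(p,y) = 0 for p =
    [u_i,x,u_j] or p = [u_i,u_j,u_k], and faithfulness gives p = 0. *)
Lemma ternary_decoupled : exists w, decoupled (shift w).
Proof.
have /choice[w hw] i := ternary_shift1 (u i); exists w.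
have E0 : forall i x, D C (shift w i) (iota x) = 0 by [].
split=> // [i j|i j k].
  apply/row_matrixP => l; rewrite rowE row0; set x : 'rV_m := delta_mx 0 l.
  apply: ternary_faithful => y; rewrite D_E.
  have := D_FI (shift w i) (iota x) (shift w j) (iota y).
  rewrite !E0 !mul0mx subrr addr0 => h.
  by rewrite br23 prN mulNmx -scaleN1r D_Zl -h scaler0.
apply: ternary_faithful => y.
have := D_FI (shift w i) (shift w j) (shift w k) (iota y).
by rewrite !E0 mulmx0 mul0mx subrr addr0 => <-.
Qed.
End TernaryBracket.

(** * Summands on which the u_i induce Lie brackets *)

Section BinaryBracket.
Hypothesis HB : forall x y, D C (iota x) (iota y) = 0.

(** The kernel of y |-> ad(a,y) is invariant: moving [a] inside ad(-,y) contributes only ad of two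
    frame vectors, which is zero by [HB]. *)
Lemma binary_ker a x : x != 0 -> D C a (iota x) = 0 ->
  forall y, D C a (iota y) = 0.
Proof.
move=> x0 hx; apply: (irred_all (N := fun x => D C a (iota x) = 0) Hirr _ _ x0 hx).
  by move=> k y z hy hz; rewrite D_iotaL hy hz scaler0 addr0.
move=> X y [b [c ->]] hy; have := D_FI b c a (iota y).
rewrite hy mulmx0 mul0mx subrr HB add0r => h.
by rewrite D_E -h.
Qed.

(** Every ad(b,c) is a derivation of the bracket [a,-,-], again because the term that moves [a]
    vanishes. For b = a and c in the frame this is the Jacobi identity. *)
Lemma binary_derivation a b c x :
  D C a (iota x) *m D C b c - D C b c *m D C a (iota x) =
  D C a (iota (x *m D C b c)).
Proof. by rewrite D_FI HB add0r D_E. Qed.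

Lemma binary_swap a b x y :
  D C a (iota (y *m D C b (iota x))) = D C b (iota (y *m D C a (iota x))).
Proof.
by rewrite -binary_derivation -opprB binary_derivation D_cyc D_iotaN opprK.
Qed.

Variable o : V.
Hypothesis Ho : exists x, D C o (iota x) != 0.

Lemma binary_inj x : D C o (iota x) = 0 -> x = 0.
Proof.
move=> hx; apply/eqP; apply: contraT => x0; case: Ho => y.
by rewrite (binary_ker x0 hx) eqxx.
Qed.

Definition casimir a : 'M_m :=
  \sum_k D C a (iota (delta_mx 0 k)) *m D C o (iota (delta_mx 0 k)).

(** Symmetry: the two factors of each term commute, their commutator being ad(a,[o,e_k,e_k]).
    Invariance: ad(b,c) is a derivation of both brackets, and [skew_contract] cancels the two
    contributions. *)
Lemma casimir_scalar a : exists t, casimir a = t%:M.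
Proof.
apply: (Schur_sym Hirr) => [|X [b [c ->]]].
  rewrite /casimir linear_sum; apply: eq_bigr => k _ /=.
  rewrite trmx_mul !D_skew mulmxN mulNmx opprK; apply/eqP.
  by rewrite -subr_eq0 binary_derivation D_cyc0 mul0mx D_0r.
apply/eqP; rewrite -subr_eq0 /casimir mulmx_suml mulmx_sumr -sumrB; apply/eqP.
pose B (x y : 'rV_m) := D C a (iota x) *m D C o (iota y).
pose e k : 'rV[R]_m := delta_mx 0 k.
transitivity (\sum_k (B (e k *m D C b c) (e k) + B (e k) (e k *m D C b c))).
  apply: eq_bigr => k _; rewrite /B -!binary_derivation mulmxBl mulmxBr !mulmxA.
  by rewrite [RHS]addrC addrA subrK.
rewrite big_split /= skew_contract ?addNr //.
- by move=> k x y z; rewrite /B D_iotaL mulmxDl scalemxAl.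
- by move=> k x y z; rewrite /B D_iotaL mulmxDr scalemxAr.
- exact: D_skew.
Qed.

(** The Casimir operator is also the Gram matrix of the mixed Killing form tr(ad(a,x) ad(o,y)). *)
Lemma casimir_orth a x y : casimir a = 0 ->
  \tr (D C a (iota x) *m (D C o (iota y))^T) = 0.
Proof.
move=> h; apply: oppr_inj; rewrite oppr0.
transitivity ((x *m casimir a *m y^T) 0 0); last by rewrite h mulmx0 mul0mx mxE.
rewrite /casimir mulmx_sumr mulmx_suml summxE -sumrN; apply: eq_bigr => k _.
set e : 'rV_m := delta_mx 0 k; rewrite mulmxA (D_cyc e x) !mulNmx -mulmxA.
have -> : D C o (iota e) *m y^T = (e *m D C o (iota y))^T.
  by rewrite D_cyc linearN /= trmx_mul D_skew mulNmx opprK.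
rewrite trmx_mul mulmxA -(mulmxA e) -(mulmxA e) -rowE trmx_delta -colE.
by rewrite !mxE.
Qed.

Lemma binary_proportional a : exists t, forall x, D C a (iota x) = t *: D C o (iota x).
Proof.
have [s hs] := casimir_scalar o; have [t ht] := casimir_scalar a.
have s0 : s != 0.
  apply/eqP => s0; case: Ho => x /negP[]; apply/eqP; move: x.
  apply: D_iota_eq0 => k; apply: mxtrace_mulT_eq0.
  by apply: casimir_orth; rewrite hs s0 raddf0.
exists (t / s); pose b := a - (t / s) *: o.
have cb : casimir b = 0.
  have -> : casimir b = casimir a - (t / s) *: casimir o.
    rewrite /casimir scaler_sumr -sumrB; apply: eq_bigr => k _.
    by rewrite /b -scaleNr D_Dl D_Zl mulmxDl -scalemxAl scaleNr.
  by rewrite hs ht scale_scalar_mx divfK // subrr.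
suff Db x : D C b (iota x) = 0.
  by move=> x; apply/eqP; rewrite -subr_eq0 -scaleNr -D_Zl -D_Dl scaleNr Db.
case: Ho => x0 /eqP/matrixP; apply: contra_notP => Dbx.
(* For z = [o,x0,y], [binary_swap] writes ad(b,z) as ad(o,-) of a frame vector, so ad(b,z) is
   orthogonal to itself. A nonzero z would then make ad(b,-) vanish on the whole frame. *)
have Z0 y : y *m D C o (iota x0) = 0.
  apply/eqP; apply: contraT => z0; exfalso; apply: Dbx.
  apply: (binary_ker z0); apply: mxtrace_mulT_eq0.
  by rewrite {2}binary_swap casimir_orth.
move=> i j; rewrite [RHS]mxE.
by have /rowP/(_ j) := Z0 (delta_mx 0 i); rewrite -rowE !mxE.
Qed.

(** The second projection argument: [o,a,-] is a skew derivation of the Lie bracket [o,-,-], and the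
    shift subtracts its inner part. *)
Lemma binary_shift1 a : exists w, D C o (a + iota w) = 0.
Proof.
pose f b b' := \tr (D C o b *m (D C o b')^T).
have fL k b b' c : f (k *: b + b') c = k * f b c + f b' c.
  by rewrite /f D_Dr D_Zr mulmxDl -scalemxAl raddfD /= mxtraceZ.
have fS b c : f b c = f c b by apply: mxtrace_mulTC.
have fpos x : f (iota x) (iota x) = 0 -> x = 0.
  by move/mxtrace_mulT_eq0/binary_inj.
have [w hw] := gram_project fL fS fpos a; exists w.
apply/row_matrixP => i; rewrite rowE row0; set y : 'rV_m := delta_mx 0 i.
apply: binary_inj; apply: mxtrace_mulT_eq0; set p := y *m _.
have Dp : D C o (iota p) = - (D C o (a + iota w) *m D C o (iota y) -
    D C o (iota y) *m D C o (a + iota w)) by rewrite /p -binary_derivation opprB.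
rewrite {1}Dp mulNmx raddfN /= mxtrace_commT ?D_skew // opprK.
by rewrite binary_derivation; apply: hw.
Qed.

Lemma binary_normal_form : (exists i, o = u i) -> exists w, exists kappa : 'I_r -> R,
  [/\ exists i, kappa i != 0,
      forall i x, D C (shift w i) (iota x) = kappa i *: D C o (iota x),
      forall i j, D C (shift w i) (shift w j) = 0 &
      forall i j k, K (shift w i) (shift w j) (shift w k) = 0].
Proof.
case=> i0 oi0; have /choice[w hw] i := binary_shift1 (u i).
have /choice[kappa hk] i := binary_proportional (u i).
have hs i x : D C (shift w i) (iota x) = kappa i *: D C o (iota x).
  by rewrite D_Dl HB addr0 hk.
(* The reference vector [o] is not moved by the shift, hence is still one of the new u_i. *)
have w0 : w i0 = 0.
  apply: binary_inj; have := hw i0; rewrite -oi0 D_Dr => <-.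
  by rewrite (eq_oppr0 (D_C o o)) add0r.
have so : shift w i0 = o by rewrite /shift w0 mul0mx addr0.
have Djj i j : D C (shift w i) (shift w j) = 0.
  apply/row_matrixP => l; rewrite rowE row0; set x : 'rV_m := delta_mx 0 l.
  apply: binary_inj; rewrite -binary_derivation; apply/eqP; rewrite -oppr_eq0 opprB.
  have := D_FI o (iota x) (shift w i) (shift w j).
  have K0 k : K o (iota x) (shift w k) = 0 by rewrite br23 prN -D_E hw mulmx0 oppr0.
  by rewrite !K0 mul0mx D_0r (D_C 0) D_0r oppr0 addr0 => ->.
exists w, kappa; split=> //.
  exists i0; case: Ho => x; apply: contra => /eqP k0.
  by have := hk i0 x; rewrite -oi0 k0 scale0r => ->.
(* Since ad(o,u_k) = 0, the fundamental identity gives ad(o,[u_i,u_j,u_k]) = kappa_k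
   ad(o,[u_i,u_j,o]), and ad(o,-) is injective. *)
have KE i j k : K (shift w i) (shift w j) (shift w k) =
    kappa k *: K (shift w i) (shift w j) o.
  apply/eqP; rewrite -subr_eq0; apply/eqP; apply: binary_inj.
  have := D_FI (shift w i) (shift w j) o (shift w k).
  rewrite hw mulmx0 mul0mx subrr (D_C _ (shift w k)) hs => e.
  by rewrite -scaleNr addrC D_iotaL scaleNr -e.
move=> i j k; rewrite KE.
(* After rotating [o] to the front, a second use of [KE] leaves [o,u_i,o] = 0. *)
have -> : br (shift w i) (shift w j) o = br (shift w i0) (shift w i) (shift w j).
  by rewrite [RHS]br_rot so.
by rewrite KE so br23 br_alt oppr0 prE !mul0mx !scaler0.
Qed.
End BinaryBracket.

(** * Summands on which only the operators ad(u_i,u_j) can act *)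

Section AbelianFrame.
Hypothesis HC0 : forall a x, D C a (iota x) = 0.

Lemma abelian_comm a b c d : D C c d *m D C a b = D C a b *m D C c d.
Proof.
apply/eqP; rewrite -subr_eq0 D_FI HC0 (D_C (iota _)) HC0 oppr0 addr0 //.
Qed.

Lemma abelian_K a c x : Zp c -> K a (iota x) c = 0.
Proof.
by move=> Zc; rewrite br23 prN -D_E D_C (D_pr _ Zc) (D_C (iota _)) HC0 !oppr0 mulmx0 oppr0.
Qed.

(** A product of two commuting skew operators is symmetric and commutes with all the others, so
    [Schur_sym] makes [D C a b *m J] scalar. The scalar of [J *m J] is negative because [J] is skew
    and nonzero. *)
Lemma abelian_proportional o o' : D C o o' != 0 ->
  exists2 s, s < 0 & D C o o' *m D C o o' = s%:M /\
    forall a b, exists t, D C a b = t *: D C o o'.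
Proof.
move=> J0; set J := D C o o' in J0 *.
have scal a b : exists t, D C a b *m J = t%:M.
  apply: (Schur_sym Hirr) => [|X [c [d ->]]].
    by rewrite trmx_mul !D_skew mulNmx mulmxN opprK abelian_comm.
  by rewrite -mulmxA [J *m _]abelian_comm !mulmxA [D C a b *m _]abelian_comm.
have [s hs] := scal o o'; rewrite -/J in hs.
have s0 : s < 0.
  rewrite ltNge; apply/negP => s0; case/eqP: J0; apply: mxtrace_mulT_eq0.
  apply/eqP; rewrite eq_le mxtrace_mulT_ge0 andbT D_skew mulmxN hs raddfN /=.
  by rewrite mxtrace_scalar oppr_le0 mulrn_wge0.
exists s => //; split=> // a b; have [t ht] := scal a b.
exists (t / s); have : D C a b *m J *m J = t *: J by rewrite ht mul_scalar_mx.
rewrite -mulmxA hs mul_mx_scalar => e.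
by rewrite mulrC -scalerA -e scalerA mulVf ?scale1r // lt_eqF.
Qed.

(** The span of x and [x *m J] is invariant, and in dimension one a skew operator is zero. *)
Lemma abelian_dim o o' : D C o o' != 0 -> m = 2.
Proof.
move=> J0; have [s s0 [JJ Jall]] := abelian_proportional J0; set J := D C o o' in J0 JJ Jall.
have m0 : (0 < m)%N by case: Hirr.
pose x : 'rV[R]_m := delta_mx 0 (Ordinal m0).
pose S := col_mx x (x *m J).
have x0 : x != 0.
  by apply/eqP => /matrixP/(_ 0 (Ordinal m0))/eqP; rewrite !mxE !eqxx oner_eq0.
have m2 : (m <= 2)%N.
  have : row_full <<S>>%MS.
    case: Hirr => _; apply.
      apply: contraNneq x0 => S0; have : (x <= <<S>>)%MS.
        by rewrite genmxE -addsmxE addsmxSl.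
      by rewrite S0 submx0.
    move=> X [a [b ->]]; have [t ->] := Jall a b.
    rewrite -scalemxAr scalemx_sub // (eqmxMr _ (genmxE S)) genmxE.
    rewrite mul_col_mx -mulmxA JJ mul_mx_scalar col_mx_sub -!addsmxE addsmxSr.
    by rewrite scalemx_sub ?addsmxSl.
  by rewrite /row_full mxrank_gen => /eqP <-; apply: rank_leq_row.
apply/eqP; rewrite eqn_leq m2 ltnNge; apply: contra J0 => m1.
apply/eqP/matrixP => i j; rewrite [RHS]mxE.
have ij : i = j.
  have z (l : 'I_m) : val l = 0.
    by apply/eqP; rewrite -leqn0 -ltnS; apply: leq_trans (ltn_ord l) m1.
  by apply/val_inj; rewrite !z.
by rewrite ij; apply: (@eq_oppr0 R^o); have /matrixP/(_ j j) := D_skew o o'; rewrite !mxE.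
Qed.

(** By [abelian_K] the bracket [a,x,[b,c,d]] has no component in the frame; this is its expansion by
    the fundamental identity. *)
Lemma abelian_plucker a b c d :
  D C a b *m D C c d + D C a c *m D C d b + D C a d *m D C b c = 0.
Proof.
apply/row_matrixP => i; rewrite rowE row0; set x : 'rV_m := delta_mx 0 i.
have := abelian_K a x (Zp_br b c d); rewrite FI !prD.
have E e : K a (iota x) e = - (x *m D C a e) by rewrite br23 prN D_E.
rewrite (br_rot _ c d) -(br_rot d b) !(pr_br _ _ (Zp_br _ _ _)) !E !mulNmx -!opprD => /eqP; rewrite oppr_eq0 => /eqP <-.
by rewrite !mulmxDr !mulmxA.
Qed.

Lemma abelian_KD a b c d e : K c d e *m D C a b =
  K a b c *m D C d e + K a b d *m D C e c + K a b e *m D C c d.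
Proof.
rewrite -(pr_br _ _ (Zp_br _ _ _)) FI !prD (br_rot _ d e) -(br_rot e c).
by rewrite !(pr_br _ _ (Zp_br _ _ _)).
Qed.

Lemma K_shift a b c w w' w'' :
  K (a + iota w) (b + iota w') (c + iota w'') =
  K a b c + (w *m D C b c + w' *m D C c a + w'' *m D C a b).
Proof.
have E1 d e x : K d e (iota x) = x *m D C d e by rewrite D_E.
have E2 d e x : K (iota x) d e = x *m D C d e by rewrite br_rot E1.
have E3 d e x : K d (iota x) e = x *m D C e d by rewrite -br_rot E1.
have E0 d x : D C (iota x) d = 0 by rewrite D_C HC0 oppr0.
rewrite !brDl !brDm !brDr !prD !E1 !E2 !E3 !HC0 !E0 !mulmx0 !addr0.
rewrite -!addrA; congr (_ + _).
by rewrite [in LHS](addrC (w' *m _)) (addrCA (w'' *m _)) (addrC (w'' *m _)).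
Qed.

Lemma D_shift a b w w' : D C (a + iota w) (b + iota w') = D C a b.
Proof. by rewrite D_Dl !D_Dr !HC0 (D_C (iota w)) HC0 oppr0 !addr0. Qed.

Lemma abelian_normal_form p q : D C (u p) (u q) != 0 -> exists w, exists J : 'M_m,
  exists eta zeta : 'I_r -> R,
  [/\ J *m J = - 1%:M,
      exists i j, eta i * zeta j - eta j * zeta i != 0,
      forall i j, D C (shift w i) (shift w j) =
                  (eta i * zeta j - eta j * zeta i) *: J &
      forall i j k, K (shift w i) (shift w j) (shift w k) = 0].
Proof.
move=> J0; have [s s0 [JJ Jall]] := abelian_proportional J0.
pose c := Num.sqrt (- s); have c0 : 0 < c by rewrite sqrtr_gt0 oppr_gt0.
have cc : c ^+ 2 = - s by rewrite sqr_sqrtr // oppr_ge0 ltW.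
pose J := c^-1 *: D C (u p) (u q).
have J2 : J *m J = - 1%:M.
  rewrite -scalemxAl -scalemxAr scalerA JJ scale_scalar_mx.
  suff -> : c^-1 * c^-1 * s = -1 by rewrite raddfN.
  by rewrite -[s]opprK -cc; field; apply: lt0r_neq0.
have DJ : D C (u p) (u q) = c *: J by rewrite scalerA divff ?scale1r // lt0r_neq0.
have nJ : J != 0 by apply: contraNneq J0 => z; rewrite DJ z scaler0.
clearbody J.
have /choice[f hf] (ij : 'I_r * 'I_r) : exists t, D C (u ij.1) (u ij.2) = t *: J.
  have [t ->] := Jall (u ij.1) (u ij.2); exists (t * c).
  by rewrite DJ scalerA.
pose j a b := f (a, b); have jE a b : D C (u a) (u b) = j a b *: J by rewrite (hf (a, b)).
have jS a b : j a b = - j b a.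
  apply/eqP; rewrite -subr_eq0 opprK; have := D_C (u a) (u b).
  rewrite !jE => /eqP; rewrite -addr_eq0 -scalerDl scaler_eq0 (negPf nJ) orbF //.
have jpq : j p q != 0 by apply: contraNneq J0 => z; rewrite jE z scale0r.
have plu a b d e : j a b * j d e + j a d * j e b + j a e * j b d = 0.
  have := abelian_plucker (u a) (u b) (u d) (u e); rewrite !jE.
  rewrite -!scalemxAl -!scalemxAr !scalerA J2 -!scalerDl => /eqP.
  rewrite scaler_eq0 oppr_eq0 => /orP[/eqP //|].
  by case: Hirr => m0 _; rewrite -mxrank_eq0 mxrank1 (gtn_eqF m0).
(* A form satisfying the Pluecker relation is decomposable: contract it with u_p and u_q and divide
   by the nonzero entry [j p q]. *)
pose eta i := j p i / j p q; pose zeta i := j q i.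
have ez i k : eta i * zeta k - eta k * zeta i = j i k.
  rewrite /eta /zeta; apply: (mulfI jpq); have := plu p q i k.
  rewrite (jS k q) => h; transitivity (j p i * j q k - j p k * j q i); first by field.
  by lra.
have mulJK x y : x *m J = y *m J -> x = y.
  move=> h; apply: oppr_inj; rewrite -(mulmx1 x) -(mulmx1 y) -!mulmxN -J2.
  by rewrite !mulmxA h.
(* Solves for the shift that cancels K in [K_shift]: by [abelian_KD] at u_p, u_q, all components of
   K are determined by those of [u_p,u_q,u_i]. *)
pose w i := (j p q)^-1 *: (K (u p) (u q) (u i) *m J).
exists w, J, eta, zeta; split=> //.
- by exists p, q; rewrite ez.
- by move=> i k; rewrite /shift D_shift jE ez.
have wE i t : j p q *: (w i *m (t *: J) *m J) = - (K (u p) (u q) (u i) *m (t *: J)).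
  rewrite /w -!scalemxAl -!scalemxAr -!scalemxAl !scalerA ?mulrA divff // mul1r.
  by rewrite -(mulmxA _ J J) J2 mulmxN mulmx1 scalerN.
move=> i k l; rewrite K_shift !jE; apply: mulJK; rewrite mul0mx.
apply/eqP; rewrite -(inj_eq (scalerI jpq)) scaler0 !mulmxDl !scalerDr !wE.
by rewrite scalemxAr -(jE p q) (abelian_KD (u p) (u q)) !jE -!opprD subrr.
Qed.

End AbelianFrame.

(** * Classification of irreducible frames *)

Definition frame_W (u' : 'I_r -> V) : Prop :=
  (forall x y, D C (iota x) (iota y) = 0) /\
  exists o, exists kappa : 'I_r -> R,
  [/\ exists x, D C o (iota x) != 0,
      exists i, kappa i != 0,
      forall i x, D C (u' i) (iota x) = kappa i *: D C o (iota x),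
      forall i j, D C (u' i) (u' j) = 0 &
      forall i j k, K (u' i) (u' j) (u' k) = 0].

Definition frame_E (u' : 'I_r -> V) : Prop :=
  m = 2 /\ (forall a x, D C a (iota x) = 0) /\
  exists J : 'M_m, exists eta zeta : 'I_r -> R,
  [/\ J *m J = - 1%:M,
      exists i j, eta i * zeta j - eta j * zeta i != 0,
      forall i j, D C (u' i) (u' j) = (eta i * zeta j - eta j * zeta i) *: J &
      forall i j k, K (u' i) (u' j) (u' k) = 0].

Definition frame_0 : Prop := forall a b, D C a b = 0.

(** The u_i span V modulo Z^perp, and a vector of Z^perp acts through its projection to the
    frame. *)
Lemma D_span (a b : V) : (forall i, D C (u i) b = 0) ->
  (forall x, D C (iota x) b = 0) -> D C a b = 0.
Proof.
move=> h hx; have [c Zc] := Hu a; rewrite -(subrK (\sum_i c i *: u i) a) D_Dl.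
rewrite (D_pr _ Zc) hx add0r D_suml big1 // => i _.
by rewrite D_Zl h scaler0.
Qed.

Lemma classify : exists w, [\/ decoupled (shift w), frame_W (shift w),
  frame_E (shift w) | frame_0].
Proof.
case: (pselect (exists x y, D C (iota x) (iota y) != 0)) => [HA|HA].
  by have [w hw] := ternary_decoupled HA; exists w; constructor 1.
have HB x y : D C (iota x) (iota y) = 0.
  by apply/eqP; apply: contra_notT HA => h; exists x, y.
case: (pselect (exists i x, D C (u i) (iota x) != 0)) => [[i [x Ho]]|HC1].
  have Ho' : exists x, D C (u i) (iota x) != 0 by exists x.
  have [|w [kappa [h1 h2 h3 h4]]] := binary_normal_form HB Ho'; first by exists i.
  by exists w; constructor 2; split=> //; exists (u i), kappa.
have HC0 a x : D C a (iota x) = 0.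
  apply: D_span => // i.
  by apply/eqP; apply: contra_notT HC1 => h; exists i, x.
case: (pselect (exists i j, D C (u i) (u j) != 0)) => [[p [q Hpq]]|H0].
  have [w [J [eta [zeta [h1 h2 h3 h4]]]]] := abelian_normal_form HC0 Hpq.
  exists w; constructor 3; split; first by apply: abelian_dim Hpq.
  by split=> //; exists J, eta, zeta.
exists (fun _ => 0); constructor 4 => a b; apply: D_span => [i|x]; last first.
  by rewrite D_C HC0 oppr0.
rewrite D_C D_span ?oppr0 // => [j|x]; last by rewrite D_C HC0 oppr0.
by apply/eqP; apply: contra_notT H0 => h; exists j, i.
Qed.

(** * Independence of central changes of the frame and of shifts in other frames *)

Section Transfer.
Variables (B : 'M[R]_(m, n)) (u1 u2 : 'I_r -> V).
Hypothesis BZ : (B <= Z)%MS.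
Hypothesis u12 : forall i, Zp (u2 i - u1 i) /\ pr C (u2 i - u1 i) = 0.

Lemma central_ad p (A : 'M_(p, n)) a b : (A <= Z)%MS -> A *m ad a b = 0.
Proof.
move=> AZ; apply/row_matrixP => i; rewrite row_mul mul_ad row0 br_rot br_rot.
by have /HZ -> : (row i A <= Z)%MS by apply: submx_trans (row_sub _ _) AZ.
Qed.

Lemma perp_central p q (A : 'M_(p, n)) (A' : 'M_(q, n)) :
  A *m G *m Z^T = 0 -> (A' <= Z)%MS -> A *m G *m A'^T = 0.
Proof. by move=> AZ /submxP[w ->]; rewrite trmx_mul mulmxA AZ mul0mx. Qed.

Lemma perp_central2 p q (A : 'M_(p, n)) (A' : 'M_(q, n)) :
  A *m G *m Z^T = 0 -> (A' <= Z)%MS -> A' *m G *m A^T = 0.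
Proof.
by move=> AZ A'Z; apply: trmx_inj; rewrite !trmx_mul trmxK G_sym mulmxA trmx0 perp_central.
Qed.

Hypothesis HZ0 : Z *m G *m Z^T = 0.

Lemma perp_shift : (C + B) *m G *m Z^T = 0.
Proof.
by rewrite !mulmxDl (frameCZ HC) add0r; apply: perp_central2.
Qed.

Lemma inv_frame_shift : inv_frame (C + B).
Proof.
split; last move=> a b c Zc.
- rewrite linearD mulmxDr (perp_central perp_shift BZ) addr0 !mulmxDl (frameCC HC).
  by rewrite (perp_central2 (frameCZ HC) BZ) addr0.
- exact: perp_shift.
rewrite !mulmxDl (perp_central2 Zc BZ) addr0 => /(frame_inv HC a b Zc) ->.
by rewrite central_ad // !mul0mx addr0.
Qed.

Lemma D_shiftZ a b : D (C + B) a b = D C a b.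
Proof.
rewrite !DE mulmxDl (central_ad _ _ BZ) addr0 linearD mulmxDr.
rewrite [X in _ + X](_ : _ = 0) ?addr0 //; apply: perp_central => //.
apply/row_matrixP => i; rewrite row0 rowE !mulmxA -rowE mul_ad.
exact: Zp_br.
Qed.

Lemma D_iotaZ a x : D C a (x *m (C + B)) = D C a (iota x).
Proof.
rewrite mulmxDr D_Dr [X in _ + X](_ : _ = 0) ?addr0 //.
have zc : (x *m B <= Z)%MS by apply: submx_trans (submxMl _ _) BZ.
rewrite D_C; apply/eqP; rewrite oppr_eq0; apply/eqP.
apply/row_matrixP => i; rewrite rowE D_E row0; move/HZ: zc => ->.
by rewrite prE !mul0mx.
Qed.

Lemma pr_shiftZ c : Zp c -> pr (C + B) c = pr C c.
Proof.
by move=> Zc; rewrite !prE linearD mulmxDr (perp_central Zc BZ) addr0.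
Qed.

Lemma D_u12 i b : D C (u2 i) b = D C (u1 i) b.
Proof.
have [Zi pi] := u12 i; rewrite -(subrK (u1 i) (u2 i)) D_Dl.
by rewrite (D_pr _ Zi) pi mul0mx D_C D_0r oppr0 add0r.
Qed.

Lemma K_u12 i j k : K (u2 i) (u2 j) (u2 k) = K (u1 i) (u1 j) (u1 k).
Proof.
have E l a b : K (u2 l) a b = K (u1 l) a b.
  have [Zl pl] := u12 l; rewrite -(subrK (u1 l) (u2 l)) brDl prD.
  by rewrite br_rot (pr_br _ _ Zl) pl mul0mx add0r.
by rewrite E -br_rot E -br_rot E -br_rot.
Qed.

Lemma K_transfer i j k :
  pr (C + B) (br (u2 i) (u2 j) (u2 k)) = K (u1 i) (u1 j) (u1 k).
Proof. by rewrite pr_shiftZ ?K_u12 //; apply: Zp_br. Qed.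

Definition transferE := (D_shiftZ, D_iotaZ, K_transfer, D_u12).

End Transfer.

(** * Orthogonal decomposition into irreducible frames *)

Section SubFrame.
Variables (p : nat) (P : 'M[R]_(p, m)).
Hypotheses (PP : P *m P^T = 1%:M) (Pinv : forall a b, (P *m D C a b <= P)%MS).

Lemma sub_frame : inv_frame (P *m C).
Proof.
split.
- by rewrite trmx_mul mulmxA -2!(mulmxA P) (frameCC HC) mulmx1.
- by rewrite -2!(mulmxA P) (frameCZ HC) mulmx0.
move=> a b c Zc PCc; rewrite -3!(mulmxA P).
rewrite -[c](subrK (pr C c *m C)) linearD mulmxDr /=.
rewrite (frame_inv HC); [|exact: Zp_res|]; last first.
  by apply/frame_perpC; rewrite -prE pr_res.
rewrite add0r trmx_mul (mulmxA _ C^T) -DE (mulmxA P).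
have /submxP[E ->] := Pinv a b; rewrite -mulmxA.
suff -> : P *m (pr C c)^T = 0 by rewrite mulmx0.
by rewrite prE !trmx_mul trmxK G_sym !mulmxA.
Qed.

Lemma sub_frame_D a b : D (P *m C) a b = P *m D C a b *m P^T.
Proof. by rewrite !DE trmx_mul !mulmxA. Qed.
End SubFrame.

End Frame.

(** An invariant subspace of least positive dimension is irreducible, and its orthogonal is
    invariant because the operators are skew. *)
Lemma irred_summand m (C : 'M[R]_(m, n)) : inv_frame C -> (0 < m)%N ->
  exists k (P : 'M_(k, m)) l (Q : 'M_(l, m)),
  [/\ (0 < k)%N /\ (k + l)%N = m,
      [/\ P *m P^T = 1%:M, Q *m Q^T = 1%:M & Q *m P^T = 0],
      (forall a b, (P *m D C a b <= P)%MS) /\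
      (forall a b, (Q *m D C a b <= Q)%MS),
      irred (D_op (P *m C)) &
      (1%:M <= P + Q)%MS].
Proof.
move=> HC m0.
pose cand k := `[< exists S : 'M[R]_m, [/\ \rank S = k, (0 < k)%N &
  forall a b, (S *m D C a b <= S)%MS] >].
have exk : exists k, cand k.
  exists m; apply/asboolP; exists 1%:M; split; rewrite ?mxrank1 //.
  by move=> a b; apply: submx1.
case: (ex_minnP exk) => k /asboolP[S [rS k0 Sinv]] mink.
have [P PP PS] := dot_frame rS.
have Pinv a b : (P *m D C a b <= P)%MS.
  by rewrite PS (eqmxMr _ PS).
have Pfree : row_free P by apply/eqP; rewrite PS.
have PD a b : P *m D C a b = P *m D C a b *m P^T *m P.
  have /submxP[E e] := Pinv a b.
  by rewrite e -(mulmxA E) PP mulmx1.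
have rQ : \rank (kermx P^T) = (m - k)%N by rewrite mxrank_ker mxrank_tr (eqP Pfree).
have [Q QQ QS] := dot_frame rQ.
have QP : Q *m P^T = 0 by apply/sub_kermxP; rewrite QS.
have PQt : P *m Q^T = 0 by apply: trmx_inj; rewrite trmx_mul trmxK QP trmx0.
have km : (k <= m)%N by rewrite -rS rank_leq_row.
exists k, P, (m - k)%N, Q; split=> //.
- by rewrite subnKC.
- split=> // a b; rewrite QS; apply/sub_kermxP.
  apply: trmx_inj; rewrite !trmx_mul trmxK D_skew trmx0 mulNmx mulmxN.
  by rewrite mulmxA PD -(mulmxA _ P) PQt mulmx0 oppr0.
- split=> // T T0 Tinv; rewrite /row_full eqn_leq rank_leq_col; apply: mink.
  apply/asboolP; exists <<T *m P>>%MS; split.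
  + by rewrite mxrank_gen mxrankMfree.
  + by rewrite lt0n mxrank_eq0.
  move=> a b; rewrite (eqmxMr _ (genmxE _)) genmxE -mulmxA PD mulmxA submxMr //.
  by rewrite -sub_frame_D; apply: Tinv; exists a, b.
rewrite sub1mx /row_full mxrank_disjoint_sum.
  by rewrite (eqP Pfree) QS rQ subnKC.
apply/eqP/rowV0P => v; rewrite sub_capmx QS => /andP[/submxP[w ->]] /sub_kermxP.
by rewrite -mulmxA PP mulmx1 => ->; rewrite mul0mx.
Qed.

(** The summands have different dimensions, so a family of frames has to carry its sizes. *)
Definition framed := {m : nat & 'M[R]_(m, n)}.
Definition fm (F : framed) : 'M_(tag F, n) := tagged F.

Lemma irred_decomposition m (C : 'M[R]_(m, n)) : inv_frame C ->
  exists k (Cs : nat -> framed),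
  [/\ forall i, (i < k)%N -> inv_frame (fm (Cs i)) /\ irred (D_op (fm (Cs i))),
      forall i j, (i < k)%N -> (j < k)%N -> i != j ->
        fm (Cs i) *m G *m (fm (Cs j))^T = 0,
      \sum_(i < k) tag (Cs i) = m,
      forall i, (i < k)%N -> (fm (Cs i) <= C)%MS &
      (C <= \sum_(i < k) <<fm (Cs i)>>)%MS].
Proof.
have [N] := ubnP m; elim: N m C => // N IH m C; rewrite ltnS => mN HC.
have [m0|m0] := posnP m.
  subst m; exists 0%N, (fun=> existT (fun m => 'M[R]_(m, n)) 0%N 0).
  by split=> //; rewrite ?big_ord0 // [C]flatmx0 sub0mx.
have [k [P [l [Q [[k0 kl] [PP QQ QP] [Pinv Qinv] Pirr PQ]]]]] := irred_summand HC m0.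
have lN : (l < N)%N by lia.
have [k' [Cs [h1 h2 h3 h4 h5]]] := IH _ (Q *m C) lN (sub_frame HC QQ Qinv).
pose Cs' i : framed :=
  if i is i'.+1 then Cs i' else existT (fun m => 'M[R]_(m, n)) k (P *m C).
have PCQ i : (i < k')%N -> fm (Cs i) *m G *m (P *m C)^T = 0.
  move=> /h4 /submxP[w ->]; rewrite -2!(mulmxA w).
  have -> : Q *m C *m G *m (P *m C)^T = 0; last by rewrite mulmx0.
  by rewrite trmx_mul !mulmxA -2!(mulmxA Q) (frameCC HC) mulmx1.
exists k'.+1, Cs'; split.
- by case=> [_|i /h1 //]; split=> //; apply: sub_frame.
- case=> [|i] [|j] //= hi hj ij; last exact: h2.
    apply: trmx_inj; rewrite !trmx_mul trmxK G_sym trmx0 mulmxA.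
    by rewrite -(PCQ j hj) trmx_mul.
  exact: PCQ.
- by rewrite big_ord_recl /= h3.
- case=> [_|i hi] /=; first exact: submxMl.
  by apply: submx_trans (h4 i hi) _; apply: submxMl.
rewrite big_ord_recl -[C in (C <= _)%MS]mul1mx.
apply: submx_trans (submxMr _ PQ) _; rewrite addsmxMr addsmx_sub; apply/andP; split.
  by apply: submx_trans _ (addsmxSl _ _); rewrite genmxE.
by apply: submx_trans _ (addsmxSr _ _); apply: h5.
Qed.

(** * Vectors dual to a basis of the centre *)

Hypothesis HZ0 : Z *m G *m Z^T = 0.

Lemma central_Z z a b : (z <= Z)%MS -> br z a b = 0.
Proof. by move/HZ; apply. Qed.

Lemma Zp_Z z : (z <= Z)%MS -> Zp z.
Proof. by case/submxP => w ->; rewrite /Zp -2!(mulmxA w) HZ0 mulmx0. Qed.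

Lemma Zp_bform c z : Zp c -> (z <= Z)%MS -> bform G c z = 0.
Proof. by move=> /bform_eq0; apply. Qed.

Lemma prP m (C : 'M[R]_(m, n)) c (x : 'rV_m) : bform G c (x *m C) = dot (pr C c) x.
Proof. by rewrite prE bformE !dotM trmxK /dot trmx_mul mulmxA. Qed.

Variables (r : nat) (v : 'I_r -> V).
Hypothesis vZ : forall i, (v i <= Z)%MS.
Hypothesis Zv : (Z <= \matrix_i v i)%MS.

Definition dual_to_v (u : 'I_r -> V) := forall i j, bform G (u i) (v j) = (i == j)%:R.

Lemma Zp_v c : (forall i, bform G c (v i) = 0) -> Zp c.
Proof.
move=> h; apply/bform_eq0 => z zZ; have /submxP[w ->] := submx_trans zZ Zv.
by rewrite mulmx_sum_row bform_sumr big1 // => i _; rewrite rowK bformZr h mulr0.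
Qed.

Lemma Zp_dual u a : dual_to_v u -> Zp (a - \sum_i bform G a (v i) *: u i).
Proof.
move=> du; apply: Zp_v => j; rewrite bformBl bform_suml (bigD1 j) //= big1.
  by rewrite bformZl du eqxx mulr1 addr0 subrr.
by move=> i ij; rewrite bformZl du (negPf ij) mulr0.
Qed.

Lemma dual_shift (u u' : 'I_r -> V) : dual_to_v u ->
  (forall i, Zp (u' i - u i)) -> dual_to_v u'.
Proof.
move=> du h i j; rewrite -(subrK (u i) (u' i)) bformDl du.
by rewrite (Zp_bform (h i) (vZ j)) add0r.
Qed.

Definition umx (u : 'I_r -> V) : 'M[R]_(r, n) := \matrix_i u i.

Lemma umx_dual u : dual_to_v u -> umx u *m G *m (umx v)^T = 1%:M.
Proof.
move=> du; apply/matrixP => i j; rewrite [RHS]mxE -du /bform !mxE.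
apply: eq_bigr => k _; rewrite !mxE; congr (_ * _).
by apply: eq_bigr => l _; rewrite !mxE.
Qed.

(* The central correction such that [C + straighten C u] is orthogonal to [u]. *)
Definition straighten m (C : 'M[R]_(m, n)) (u : 'I_r -> V) : 'M[R]_(m, n) :=
  - (C *m G *m (umx u)^T *m umx v).

Lemma straighten_Z m (C : 'M[R]_(m, n)) u : (straighten C u <= Z)%MS.
Proof.
rewrite /straighten -mulNmx; apply: submx_trans (submxMl _ _) _.
by apply/row_subP => i; rewrite rowK.
Qed.

Lemma straighten_perp m (C : 'M[R]_(m, n)) u i x : dual_to_v u ->
  bform G (x *m (C + straighten C u)) (u i) = 0.
Proof.
move=> du; suff h : (C + straighten C u) *m G *m (umx u)^T = 0.
  have -> : u i = row i (umx u) by rewrite rowK.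
  have /bform_eq0 -> // : x *m (C + straighten C u) *m G *m (umx u)^T = 0.
    by rewrite -2!(mulmxA x) h mulmx0.
  exact: row_sub.
have vu : umx v *m G *m (umx u)^T = 1%:M.
  by apply: trmx_inj; rewrite trmx1 -(umx_dual du) !trmx_mul trmxK G_sym mulmxA.
rewrite /straighten !mulmxDl; set X := C *m G *m (umx u)^T.
by rewrite !mulNmx -2!(mulmxA X) vu mulmx1 subrr.
Qed.

(** * A decoupled frame is an orthogonal direct summand *)

Section Decoupled.
Variables (m : nat) (C : 'M[R]_(m, n)) (u : 'I_r -> V).
Hypotheses (HC : inv_frame C) (du : dual_to_v u) (Hd : decoupled C u).
Hypothesis Cu : forall x i, bform G (x *m C) (u i) = 0.

Lemma frame_nondeg e : (forall i, bform G e (u i) = 0) -> pr C e = 0 ->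
  (forall c, Zp c -> pr C c = 0 -> bform G e c = 0) -> e = 0.
Proof.
move=> eu eC eZ; apply: bform_nondeg => y.
rewrite -(subrK (\sum_i bform G y (v i) *: u i) y); set c := y - _.
have Zc : Zp c by apply: Zp_dual.
rewrite bformDr bform_sumr big1 => [|i _]; last by rewrite bformZr eu mulr0.
rewrite addr0 -(subrK (pr C c *m C) c) bformDr prP eC /dot mul0mx mxE addr0.
by apply: eZ; [apply: Zp_res|apply: pr_res].
Qed.

Lemma br_frame0 a b x : x *m D C a b = 0 ->
  (forall i, bform G (br a b (x *m C)) (u i) = 0) -> br a b (x *m C) = 0.
Proof.
move=> h1 h2; apply: frame_nondeg => //; first by rewrite -D_E.
move=> c Zc; rewrite prE => /frame_perpC pc.
rewrite -mul_ad /bform -3!(mulmxA x) !mulmxA -3!(mulmxA x).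
by rewrite (frame_inv HC) // mulmx0 mxE.
Qed.

(** [decoupled] speaks modulo Z. The central components are pairings with the u_k, which alternation
    turns into components already known to vanish: [s1] comes from [u_i,u_j,u_k], and [s2] from
    [s1]. *)
Lemma decoupled_br x y z : pr C y = 0 -> br y z (x *m C) = 0.
Proof.
case: Hd => d1 d2 d3 py.
have s1 i j a : br (u i) (u j) (a *m C) = 0.
  apply: br_frame0 => [|k]; first by rewrite d2 mulmx0.
  by rewrite w34 prP d3 /dot mul0mx mxE oppr0.
have s2 i a b : br (u i) (a *m C) (b *m C) = 0.
  apply: br_frame0 => [|k]; first by rewrite d1 mulmx0.
  by rewrite w34 br23 s1 oppr0 bform0l oppr0.
have s3 c b a : Zp c -> pr C c = 0 -> br c b (a *m C) = 0 by apply: br_perp.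
have Cuk i : pr C (u i) = 0.
  by apply/rowP => k; rewrite [RHS]mxE -(Cu (delta_mx 0 k) i) bformC prP dot_delta.
have res c : pr C (c - \sum_i bform G c (v i) *: u i) = pr C c.
  rewrite prD prN; apply/eqP; rewrite -subr_eq0 addrAC subrr add0r oppr_eq0.
  rewrite prE mulmx_suml mulmx_suml big1 // => i _.
  by rewrite -!scalemxAl -prE Cuk scaler0.
rewrite -(subrK (\sum_i bform G y (v i) *: u i) y) brDl s3 ?res // ?add0r; last exact: Zp_dual.
rewrite br_suml big1 // => i _; rewrite brZl.
rewrite -(subrK (\sum_i bform G z (v i) *: u i) z); set c := z - _.
have Zc : Zp c by apply: Zp_dual.
rewrite brDm br_summ [X in _ + X]big1 => [|j _]; last by rewrite brZm s1 scaler0.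
rewrite addr0 -(subrK (pr C c *m C) c) brDm s2 addr0 br12 s3 ?oppr0 ?scaler0 //.
  exact: Zp_res.
exact: pr_res.
Qed.

Lemma decoupled_decomposable : (0 < m)%N -> (0 < r)%N -> decomposable G br.
Proof.
move=> m0 r0; exists <<C>>%MS, (kermx (G *m C^T)).
have U2P y : (y <= kermx (G *m C^T))%MS <-> pr C y = 0.
  by rewrite prE -mulmxA; split=> /sub_kermxP.
have U12 y : (y - pr C y *m C <= kermx (G *m C^T))%MS by apply/U2P; apply: pr_res.
have br0 x y z : (x <= <<C>>)%MS -> (y <= kermx (G *m C^T))%MS -> br x y z = 0.
  by rewrite genmxE => /submxP[a ->] /U2P py; rewrite br_rot decoupled_br.
split=> //.
- rewrite mxrank_gen (frame_rank (frameCC HC)); split=> //.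
  have v0 : v (Ordinal r0) != 0.
    apply/eqP => v0; have := du (Ordinal r0) (Ordinal r0).
    by rewrite v0 bform0r eqxx => /esym/eqP; rewrite oner_eq0.
  rewrite lt0n mxrank_eq0; apply: contraNneq v0 => k0; rewrite -submx0 -k0.
  apply/sub_kermxP; rewrite mulmxA; apply: perp_central2 (vZ _).
  exact: frameCZ HC.
- split.
    apply/andP; split; first exact: submx1.
    apply/row_subP => i; set y := row i _; rewrite -(subrK (pr C y *m C) y) addrC.
    by rewrite addmx_sub_adds // genmxE submxMl.
  apply/mxdirect_addsP/eqP/rowV0P => y; rewrite sub_capmx genmxE => /andP[/submxP[w ->]].
  by move/U2P; rewrite frameK // => ->; rewrite mul0mx.
- move=> x y; rewrite genmxE => /submxP[w ->] /U2P py.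
  by rewrite bformC prP py /dot mul0mx mxE.
- split=> x y z xU yU zU; last first.
    apply/U2P/rowP => k; rewrite [RHS]mxE.
    transitivity (bform G (br x y z) (delta_mx 0 k *m C)).
      by rewrite prP dot_delta.
    by rewrite w34 br_rot br_rot br0 ?bform0l ?oppr0 // genmxE submxMl.
  set t := br x y z; suff -> : t = pr C t *m C by rewrite genmxE submxMl.
  apply/eqP; rewrite -subr_eq0; apply/eqP; apply: bform_nondeg => s.
  rewrite -(subrK (pr C s *m C) s) bformDr prP pr_res // /dot mul0mx mxE addr0.
  rewrite bformBl (bformC (pr C t *m C)) prP pr_res // /dot mul0mx mxE subr0.
  by rewrite w34 br23 br0 ?oppr0 ?bform0l ?oppr0.
Qed.
End Decoupled.

(** * Positivity of Z^perp / Z and the simultaneous normal form *)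

Hypotheses (Hidx : index_of G r) (Zr : \rank Z = r) (r_gt0 : (0 < r)%N).
Hypothesis Hind : indecomposable G br.

(** Otherwise Z + x would be a space of dimension r + 1 on which the form is nonpositive, and it
    would meet a positive subspace of dimension at least n - r. *)
Lemma Zperp_posdef x : Zp x -> ~~ (x <= Z)%MS -> 0 < bform G x x.
Proof.
move=> Zx xZ; have [B rB posB] := sym_pos_subspace G_sym G_unit Hidx.
rewrite ltNge; apply/negP => xx.
have rZx : \rank (Z + x)%MS = r.+1.
  rewrite mxrank_disjoint_sum; last first.
    apply/eqP/rowV0P => y; rewrite sub_capmx => /andP[yZ /sub_rVP[a ya]].
    have [a0|a0] := eqVneq a 0; first by rewrite ya a0 scale0r.
    by case/negP: xZ; rewrite -(scalerK a0 x) -ya scalemx_sub.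
  have -> : \rank x = 1%N by rewrite rank_rV; case: eqP xZ => // ->; rewrite sub0mx.
  by rewrite Zr addn1.
have : (B :&: (Z + x))%MS != 0.
  rewrite -mxrank_eq0 -lt0n; have := mxrank_sum_cap B (Z + x)%MS.
  rewrite rZx; have := rank_leq_col (B + (Z + x))%MS; lia.
case/rowV0Pn => y; rewrite sub_capmx => /andP[yB /sub_addsmxP[[w1 w2] /= yE]] y0.
have := posB y yB y0; rewrite yE [w2]mx11_scalar mul_scalar_mx.
set z := w1 *m Z; have zZ : (z <= Z)%MS by apply: submxMl.
rewrite !bformDl !bformDr !bformZl !bformZr (bformC z x) !(Zp_bform Zx zZ).
rewrite (Zp_bform (Zp_Z zZ) zZ) !mulr0 !add0r ltNge => /negP; apply.
by rewrite mulrA -expr2 mulr_ge0_le0 ?sqr_ge0.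
Qed.

Lemma frame_of_Zperp : (2 * r <= n)%N /\
  exists2 C : 'M[R]_(n - 2 * r, n), inv_frame C &
    forall c, Zp c -> (c <= C + Z)%MS.
Proof.
pose A := kermx (G *m Z^T).
have AP p (c : 'M_(p, n)) : (c <= A)%MS <-> c *m G *m Z^T = 0.
  by rewrite -mulmxA; split=> /sub_kermxP.
have ZA : (Z <= A)%MS by apply/AP.
have rA : \rank A = (n - r)%N.
  by rewrite mxrank_ker -mxrank_tr trmx_mul trmxK G_sym mxrankMfree ?row_free_unit ?G_unit // Zr.
have rAZ : \rank (A :&: Z)%MS = r.
  by rewrite -Zr; apply/eqP; rewrite eqn_leq !mxrankS ?capmxSr // sub_capmx ZA submx_refl.
have le : (2 * r <= n)%N.
  by have := mxrankS ZA; have := rank_leq_row Z; rewrite rA Zr; lia.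
have rW : \rank (A :\: Z)%MS = (n - 2 * r)%N.
  by have := mxrank_cap_compl A Z; rewrite rAZ rA; lia.
split=> //; have [x xW x0|C CC CW] := posdef_frame G_sym rW.
  apply: Zperp_posdef; first by apply/AP; apply: submx_trans xW (diffmxSl _ _).
  apply: contra x0 => xZ; rewrite -submx0 -(capmx_diff A Z) sub_capmx xW.
  exact: xZ.
have CA : (C <= A)%MS by rewrite CW diffmxSl.
have dec c : Zp c -> (c <= C + Z)%MS.
  move/AP; rewrite -(addsmx_diff_cap_eq A Z) => h; apply: submx_trans h _.
  by rewrite addsmxS ?CW ?capmxSr.
exists C => //; split=> // [|a b c Zc cC]; first exact/AP.
(* The frame fills Z^perp modulo Z, so a vector of Z^perp orthogonal to it is central, and every
   bracket is orthogonal to Z. *)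
suff cZ : (c <= Z)%MS.
  apply: perp_central => //; apply/row_matrixP => i.
  by rewrite row0 rowE !mulmxA -rowE mul_ad; apply: Zp_br.
have /sub_addsmxP[[w1 w2] /= cE] := dec c Zc; rewrite cE.
have := proj2 (frame_perpC _ _) cC; rewrite cE !mulmxDl -2!(mulmxA w1) CC mulmx1.
rewrite (perp_central2 (A := C)) ?addr0 ?submxMl //; last exact/AP.
by move=> ->; rewrite mul0mx add0r submxMl.
Qed.

Lemma dual_exists : exists u, dual_to_v u.
Proof.
have vf : row_free (umx v).
  by rewrite /row_free eqn_leq rank_leq_row /= -{1}Zr mxrankS.
pose U := (pinvmx (umx v))^T *m invmx G.
have UE : U *m G *m (umx v)^T = 1%:M.
  by rewrite mulmxKV ?G_unit // -trmx_mul mulmxVp // trmx1.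
exists (fun i => row i U) => i j.
have /matrixP/(_ i j) := UE; rewrite [RHS]mxE => <-; rewrite /bform !mxE.
apply: eq_bigr => k _; rewrite !mxE; congr (_ * _).
by apply: eq_bigr => l _; rewrite !mxE.
Qed.

Lemma normal_form : exists (u : 'I_r -> V) k (Cs : nat -> framed),
  [/\ dual_to_v u /\ (forall i j, bform G (u i) (u j) = 0),
      forall b, (b < k)%N ->
        [/\ inv_frame (fm (Cs b)), irred (D_op (fm (Cs b))),
            forall x i, bform G (x *m fm (Cs b)) (u i) = 0 &
            [\/ frame_W (fm (Cs b)) u, frame_E (fm (Cs b)) u |
                frame_0 (fm (Cs b))]],
      forall b c, (b < k)%N -> (c < k)%N -> b != c ->
        fm (Cs b) *m G *m (fm (Cs c))^T = 0,
      n = (2 * r + \sum_(b < k) tag (Cs b))%N &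
      forall c, Zp c -> (c <= \sum_(b < k) <<fm (Cs b)>> + Z)%MS].
Proof.
have [le [C0 HC0 C0Z]] := frame_of_Zperp; have [u0 du0] := dual_exists.
have [k [Cs [CsI Cs0 sumd _ C0Cs]]] := irred_decomposition HC0.
have Hu a : exists c : 'I_r -> R, Zp (a - \sum_i c i *: u0 i).
  by exists (fun i => bform G a (v i)); apply: Zp_dual.
pose cl (b : 'I_k) :=
  cid (classify (proj1 (CsI b (ltn_ord b))) (proj2 (CsI b (ltn_ord b))) Hu).
pose w b := sval (cl b); have hw b := svalP (cl b).
rewrite -/(w _) in hw.
(* All shifts at once: seen from one frame, the shifts along the other frames are invisible. *)
pose t i := u0 i + \sum_(b < k) w b i *m fm (Cs b).
(* The factor 1/2 appears because <t_i,t_j> is corrected once from each argument. The correction is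
   central and leaves all operators unchanged. *)
pose u i := t i - \sum_j (2^-1 * bform G (t i) (t j)) *: v j.
have Zw b i : Zp (w b i *m fm (Cs b)) by apply: Zp_frame; apply: (CsI b _).1.
have dt : dual_to_v t.
  by apply: (dual_shift du0) => i; rewrite /t addrC addKr; apply: Zp_sum.
have Zuv (c : 'I_r -> R) : Zp (\sum_j c j *: v j).
  by apply: Zp_sum => j _; apply/ZpZ/Zp_Z/vZ.
have du : dual_to_v u.
  by apply: (dual_shift dt) => i; rewrite /u addrC addKr; apply/ZpN/Zuv.
exists u, k.
exists (fun b => existT (fun m => 'M[R]_(m, n)) (tag (Cs b))
  (fm (Cs b) + straighten (fm (Cs b)) u)).
split=> //.
- split=> // i j.
  have bv a p : bform G (t a) (\sum_l p l *: v l) = p a.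
    rewrite bform_sumr (bigD1 a) //= bformZr dt eqxx mulr1 big1 ?addr0 // => l la.
    by rewrite bformZr dt eq_sym (negPf la) mulr0.
  rewrite /u bformBl bformBr bv (bformC (\sum_l _)) bformBl bv.
  rewrite (Zp_bform (Zuv _)) ?subr0; last first.
    by apply: summx_sub => l _; apply: scalemx_sub.
  by rewrite (bformC (t j)); field.
- move=> b bk; have [Ib irb] := CsI b bk; pose o := Ordinal bk.
  set C := fm (Cs b) in Ib irb *; rewrite /fm /=.
  have sZ := straighten_Z C u.
  have u12 i : Zp (u i - shift C u0 (w o) i) /\ pr C (u i - shift C u0 (w o) i) = 0.
    have -> : u i - shift C u0 (w o) i = \sum_(c < k | c != o) w c i *m fm (Cs c)
        - \sum_j (2^-1 * bform G (t i) (t j)) *: v j.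
      rewrite /u /shift; set X := \sum_j _.
      have -> : t i = u0 i + w o i *m C + \sum_(c < k | c != o) w c i *m fm (Cs c).
        by rewrite /t (bigD1 o) //= addrA.
      by rewrite addrAC; congr (_ - _); rewrite addrC addKr.
    split; first by apply: ZpD; [apply: Zp_sum => c _|apply/ZpN/Zuv].
    apply/rowP => l; rewrite [RHS]mxE.
    suff h : forall x, dot (pr C (\sum_(c < k | c != o) w c i *m fm (Cs c)
        - \sum_j (2^-1 * bform G (t i) (t j)) *: v j)) x = 0.
      by have := h (delta_mx 0 l); rewrite dot_delta.
    move=> x; rewrite -prP bformBl bform_suml big1 => [|c co]; last first.
      rewrite /bform trmx_mul mulmxA -2!(mulmxA (w c i)) Cs0 //.
      by rewrite mulmx0 mul0mx mxE.
    rewrite bformC (Zp_bform (Zp_frame Ib x)) ?subr0 //.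
    by apply: summx_sub => l' _; apply: scalemx_sub.
  have Ib' := inv_frame_shift Ib sZ HZ0.
  have [[[eD eI] eK] eu] := transferE Ib sZ u12.
  have irb' : irred (D_op (C + straighten C u)).
    case: irb => m0 irb; split=> // S S0 Sinv; apply: irb => // X [x [y ->]].
    by apply: Sinv; exists x, y; rewrite eD.
  split=> //.
    by move=> x i; apply: straighten_perp.
  have eK' i j l : pr (C + straighten C u) (br (u i) (u j) (u l)) =
    pr C (br (shift C u0 (w o) i) (shift C u0 (w o) j) (shift C u0 (w o) l)).
    exact: eK.
  case: (hw o); rewrite -/C.
  + move=> dec; case: Hind.
    apply: (decoupled_decomposable Ib' du) => //; last by case: irb.
      case: dec => d1 d2 d3; split.
      * by move=> i x; rewrite eD eI eu d1.
      * by move=> i j; rewrite eD eu D_C eu -D_C d2.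
      * by move=> i j l; rewrite eK' d3.
    by move=> x i; apply: straighten_perp.
  + case=> d0 [a [kap [d1 d2 d3 d4 d5]]]; constructor 1.
    have eI' x a' : D (C + straighten C u) (x *m (C + straighten C u)) a' =
        D C (x *m C) a' by rewrite eD D_C eI -D_C.
    split=> [x y|]; first by rewrite eI' eI d0.
    exists a, kap; split=> //.
    * by case: d1 => x hx; exists x; rewrite eD eI.
    * by move=> i x; rewrite !eD !eI eu d3.
    * by move=> i j; rewrite eD eu D_C eu -D_C d4.
    * by move=> i j l; rewrite eK' d5.
  + case=> m2 [d0 [J [eta [zeta [d1 d2 d3 d4]]]]]; constructor 2.
    split=> //; split=> [a x|]; first by rewrite eD eI d0.
    exists J, eta, zeta; split=> //.
    * by move=> i j; rewrite eD eu D_C eu -D_C d3.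
    * by move=> i j l; rewrite eK' d4.
  + by move=> d0; constructor 3 => a a'; rewrite eD d0.
- move=> b c bk ck bc; rewrite /fm /= linearD mulmxDr !mulmxDl.
  have [Ib _] := CsI b bk; have [Ic _] := CsI c ck.
  rewrite (Cs0 b c) // add0r (perp_central2 (frameCZ Ic) (straighten_Z _ _)) add0r.
  rewrite -mulmxDl -mulmxDl; apply: perp_central (straighten_Z _ _).
  exact: (perp_shift Ib (straighten_Z _ _) HZ0).
- by rewrite sumd subnKC.
move=> c Zc; apply: submx_trans (C0Z c Zc) _; rewrite addsmx_sub addsmxSr andbT.
apply: submx_trans C0Cs _; apply/sumsmx_subP => b _; rewrite genmxE.
have -> : fm (Cs b) = (fm (Cs b) + straighten (fm (Cs b)) u) - straighten (fm (Cs b)) u.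
  by rewrite addrK.
rewrite -[_ - _]/(_ + _) addmx_sub_adds //; last by rewrite eqmx_opp straighten_Z.
by rewrite (sumsmx_sup b) // genmxE.
Qed.

(** * Explicit brackets on the summands *)

Section Assembly.
Variables (u : 'I_r -> V) (k : nat) (Cs : nat -> framed).
Hypotheses (du : dual_to_v u) (uu : forall i j, bform G (u i) (u j) = 0).
Hypothesis CsP : forall b, (b < k)%N ->
  [/\ inv_frame (fm (Cs b)), irred (D_op (fm (Cs b))),
      forall x i, bform G (x *m fm (Cs b)) (u i) = 0 &
      [\/ frame_W (fm (Cs b)) u, frame_E (fm (Cs b)) u | frame_0 (fm (Cs b))]].
Hypothesis Cs_orth : forall b c, (b < k)%N -> (c < k)%N -> b != c ->
  fm (Cs b) *m G *m (fm (Cs c))^T = 0.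
Hypothesis Cs_span : forall c, Zp c -> (c <= \sum_(b < k) <<fm (Cs b)>> + Z)%MS.

Notation C b := (fm (Cs (nat_of_ord b))).
Notation d b := (tag (Cs (nat_of_ord b))).

Lemma CsI (b : 'I_k) : inv_frame (C b).
Proof. by case: (CsP (ltn_ord b)). Qed.
Lemma Cs_irr (b : 'I_k) : irred (D_op (C b)).
Proof. by case: (CsP (ltn_ord b)). Qed.
Lemma Cs_u (b : 'I_k) x i : bform G (x *m C b) (u i) = 0.
Proof. by case: (CsP (ltn_ord b)). Qed.

Lemma pr_neq (b c : 'I_k) x : b != c -> pr (C b) (x *m C c) = 0.
Proof.
move=> bc; rewrite prE -2!(mulmxA x) Cs_orth ?mulmx0 //.
by rewrite eq_sym.
Qed.

Lemma sum_expand (S : pred 'I_k) x : (x <= \sum_(b | S b) <<C b>>)%MS ->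
  x = \sum_(b | S b) pr (C b) x *m C b.
Proof.
move=> xS; have [w ->] : exists w : forall b : 'I_k, 'rV_(d b),
    x = \sum_(b | S b) w b *m C b.
  have /sub_sumsmxP[w ->] := xS.
  have wb (b : 'I_k) : exists y, w b *m <<C b>>%MS = y *m C b.
    have : (w b *m <<C b>>%MS <= C b)%MS by rewrite -(genmxE (C b)) submxMl.
    by case/submxP => y ->; exists y.
  exists (fun b => sval (cid (wb b))); apply: eq_bigr => b _.
  exact: svalP (cid (wb b)).
apply: eq_bigr => b Sb; congr (_ *m _); symmetry.
rewrite prE !mulmx_suml (bigD1 b) //= -prE (frameK (CsI b)).
by rewrite big1 ?addr0 // => c /andP[_ cb]; rewrite -prE pr_neq // eq_sym.
Qed.

Lemma Zp_C (b : 'I_k) x : Zp (x *m C b).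
Proof. exact: Zp_frame (CsI b) x. Qed.

Lemma Zp_expand c : Zp c ->
  c = \sum_(b < k) pr (C b) c *m C b + \sum_l bform G c (u l) *: v l.
Proof.
move=> Zc; have /sub_addsmxP[[w1 w2] /= cE] := Cs_span Zc.
set x := w1 *m _ in cE; set z := w2 *m Z in cE.
have zZ : (z <= Z)%MS by apply: submxMl.
have xE : x = \sum_(b < k) pr (C b) x *m C b by apply: sum_expand; apply: submxMl.
have prz (b : 'I_k) : pr (C b) z = 0.
  by rewrite prE; apply: perp_central2 zZ; apply: (frameCZ (CsI b)).
have xu l : bform G x (u l) = 0.
  by rewrite xE bform_suml big1 // => b _; apply: Cs_u.
rewrite {1}cE; congr (_ + _).
  by rewrite {1}xE; apply: eq_bigr => b _; rewrite cE prD prz addr0.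
have /submxP[y zy] := submx_trans zZ Zv.
rewrite [LHS]zy mulmx_sum_row; apply: eq_bigr => l _; rewrite rowK; congr (_ *: _).
rewrite cE bformDl xu add0r zy mulmx_sum_row bform_suml (bigD1 l) //= rowK.
rewrite bformZl bformC du eqxx mulr1 big1 ?addr0 // => i il.
by rewrite rowK bformZl bformC du eq_sym (negPf il) mulr0.
Qed.

(** The coefficient of v_l is the pairing with u_l, since the frames are orthogonal to the u_i;
    [w34] moves it onto [a,a',u_l]. *)
Lemma br_C (b : 'I_k) a a' x : br a a' (x *m C b) = x *m D (C b) a a' *m C b
  - \sum_l dot (pr (C b) (br a a' (u l))) x *: v l.
Proof.
rewrite [LHS](Zp_expand (Zp_br _ _ _)) (bigD1 b) //= big1 => [|c cb]; last first.
  by rewrite (pr_br (CsI c) _ _ (Zp_C x)) pr_neq // mul0mx mul0mx.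
rewrite addr0 D_E -sumrN; congr (_ + _); apply: eq_bigr => l _.
by rewrite w34 prP scaleNr.
Qed.

Lemma br_cross (S S' : pred 'I_k) a x y : (forall b, S b -> S' b -> False) ->
  (x <= \sum_(b | S b) <<C b>>)%MS -> (y <= \sum_(b | S' b) <<C b>>)%MS ->
  br a x y = 0.
Proof.
move=> SS' /sum_expand -> /sum_expand ->.
rewrite br_summ big1 // => b Sb; rewrite br_sumr big1 // => c Sc.
rewrite br12 (br_perp (CsI c)) ?oppr0 //; first exact: Zp_C.
by apply: pr_neq; apply/eqP => cb; apply: (SS' b) => //; rewrite -cb.
Qed.

Lemma orth_cross (S S' : pred 'I_k) x y : (forall b, S b -> S' b -> False) ->
  (x <= \sum_(b | S b) <<C b>>)%MS -> (y <= \sum_(b | S' b) <<C b>>)%MS ->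
  bform G x y = 0.
Proof.
move=> SS' /sum_expand -> /sum_expand ->.
rewrite bform_suml big1 // => b Sb; rewrite bform_sumr big1 // => c Sc.
rewrite prP pr_neq /dot ?mul0mx ?mxE //.
by apply/eqP => cb; apply: (SS' b) => //; rewrite -cb.
Qed.

Lemma sum_perp_u (S : pred 'I_k) x i : (x <= \sum_(b | S b) <<C b>>)%MS ->
  bform G x (u i) = 0.
Proof. by move=> /sum_expand ->; rewrite bform_suml big1 // => b _; apply: Cs_u. Qed.

Lemma sum_Zp (S : pred 'I_k) x : (x <= \sum_(b | S b) <<C b>>)%MS -> Zp x.
Proof. by move=> /sum_expand ->; apply: Zp_sum => b _; apply: Zp_C. Qed.

Lemma sum_posdef (S : pred 'I_k) : posdef G (\sum_(b | S b) <<C b>>)%MS.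
Proof.
move=> x xS x0; apply: Zperp_posdef; first exact: sum_Zp xS.
apply: contra x0 => xZ; rewrite (Zp_expand (Zp_Z xZ)) big1 => [|b _]; last first.
  by rewrite prE (perp_central2 (frameCZ (CsI b)) xZ) mul0mx.
by rewrite add0r big1 // => l _; rewrite (sum_perp_u _ xS) scale0r.
Qed.

Definition W_data (b : 'I_k) (kappa : 'I_r -> R) (lb : V -> V -> V) : Prop :=
  [/\ exists i, kappa i != 0,
      metric_simple_Lie G <<C b>>%MS lb,
      forall i j x, (x <= C b)%MS -> br (u i) (u j) x = 0,
      forall i x y, (x <= C b)%MS -> (y <= C b)%MS ->
        br (u i) x y = kappa i *: lb x y &
      forall x y z, (x <= C b)%MS -> (y <= C b)%MS -> (z <= C b)%MS ->
        br x y z = - (bform G (lb x y) z *: \sum_(i < r) kappa i *: v i)].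

Definition E_data (b : 'I_k) (eta zeta : 'I_r -> R) (H : V -> V) : Prop :=
  [/\ exists i j, eta i * zeta j - eta j * zeta i != 0,
      complex_structure <<C b>>%MS H,
      forall i j x, (x <= C b)%MS ->
        br (u i) (u j) x = (eta i * zeta j - eta j * zeta i) *: H x,
      forall i x y, (x <= C b)%MS -> (y <= C b)%MS ->
        br (u i) x y =
        - \sum_(j < r) bform G x ((eta i * zeta j - eta j * zeta i) *: H y) *: v j &
      forall x y z, (x <= C b)%MS -> (y <= C b)%MS -> (z <= C b)%MS ->
        br x y z = 0].

Lemma CK (b : 'I_k) x : (x <= C b)%MS -> pr (C b) x *m C b = x.
Proof. by case/submxP => w ->; rewrite frameK //; apply: CsI. Qed.

Lemma br_uuC (b : 'I_k) i j x :
  (forall l, pr (C b) (br (u i) (u j) (u l)) = 0) ->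
  br (u i) (u j) (x *m C b) = x *m D (C b) (u i) (u j) *m C b.
Proof.
move=> K0; rewrite br_C [X in _ - X]big1 ?subr0 // => l _.
by rewrite K0 /dot mul0mx mxE scale0r.
Qed.

Lemma br_uCC (b : 'I_k) i x y : br (u i) (x *m C b) (y *m C b) =
  y *m D (C b) (u i) (x *m C b) *m C b +
  \sum_l dot (x *m D (C b) (u i) (u l)) y *: v l.
Proof.
rewrite br_C -sumrN; congr (_ + _); apply: eq_bigr => l _.
by rewrite br23 prN -D_E -scaleNr /dot mulNmx mxE opprK.
Qed.

Lemma br_CCC (b : 'I_k) x y z : br (x *m C b) (y *m C b) (z *m C b) =
  z *m D (C b) (x *m C b) (y *m C b) *m C b -
  \sum_l dot (y *m D (C b) (u l) (x *m C b)) z *: v l.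
Proof.
rewrite br_C; congr (_ - _); apply: eq_bigr => l _.
by rewrite -br_rot -D_E.
Qed.

Lemma frame_E_data b : frame_E (C b) u -> exists eta zeta H, E_data b eta zeta H.
Proof.
case=> _ [D0 [J [eta [zeta [JJ nz DJ K0]]]]].
have Js : J^T = - J.
  have [i [j ij]] := nz; apply: (scalerI ij).
  by rewrite -linearZ /= -DJ D_skew DJ scalerN.
pose H x := pr (C b) x *m J *m C b.
exists eta, zeta, H; split=> //.
- split=> [x _|a x y _ _|x].
  + by rewrite genmxE submxMl.
  + by rewrite /H prD prZ !mulmxDl -!scalemxAl.
  rewrite genmxE => xC; rewrite /H (frameK (CsI b)).
  by rewrite -(mulmxA _ J J) JJ mulmxN mulmx1 mulNmx CK.
- move=> i j x /CK <-; rewrite br_uuC // DJ /H (frameK (CsI b)).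
  by rewrite -scalemxAr -scalemxAl.
- move=> i x y /CK <- /CK <-; set x' := pr _ x; set y' := pr _ y.
  rewrite br_uCC D0 mulmx0 mul0mx add0r -sumrN; apply: eq_bigr => j _.
  rewrite -scaleNr; congr (_ *: _).
  rewrite bformZr /H (frameK (CsI b)).
  rewrite prP (frameK (CsI b)).
  by rewrite DJ -scalemxAr dotZl dotM Js mulmxN dotNr mulrN.
move=> x y z /CK <- /CK <- /CK <-; rewrite br_CCC D0 mulmx0 mul0mx add0r big1 ?oppr0 //.
by move=> l _; rewrite D0 mulmx0 /dot mul0mx mxE scale0r.
Qed.

Lemma frame_W_data b : frame_W (C b) u -> exists kappa lb, W_data b kappa lb.
Proof.
case=> D0 [o [kappa [[x0 Ho] nz DK Duu K0]]].
pose A x := D (C b) o (x *m C b).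
(* The Lie bracket is the frame part of [o,x,y]. *)
pose lb x y := pr (C b) y *m A (pr (C b) x) *m C b.
have lbE x y : lb (x *m C b) (y *m C b) = y *m A x *m C b.
  by rewrite /lb !frameK //; apply: CsI.
have Acyc x y : y *m A x = - (x *m A y) by rewrite /A D_cyc.
have AL c x y : A (c *: x + y) = c *: A x + A y by rewrite /A D_iotaL.
have As x : (A x)^T = - A x by apply: D_skew.
exists kappa, lb; split=> //.
- split.
  + by move=> x y _ _; rewrite genmxE submxMl.
  + move=> a x x' y _ _ _; rewrite /lb !prD !prZ AL mulmxDr !mulmxDl.
    by rewrite -scalemxAr -!scalemxAl.
  + move=> x y z; rewrite !genmxE => /CK <- /CK <- /CK <-; rewrite !lbE.
    split; first by rewrite Acyc mulNmx.
    move: (pr _ x) (pr _ y) (pr _ z) => {}x {}y {}z.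
    rewrite -!mulmxDl; suff -> : z *m A y *m A x + x *m A z *m A y + y *m A x *m A z = 0.
      by rewrite mul0mx.
    (* The Jacobi identity: ad(o,x) is a derivation of [o,-,-]. *)
    have := binary_derivation (CsI b) D0 o o (x *m C b) y.
    rewrite -/(A y) -/(A x) -/(A _) => /(congr1 (mulmx z)).
    rewrite mulmxBr !mulmxA (Acyc _ z) (Acyc x z) mulNmx opprK => /eqP.
    by rewrite -subr_eq0 opprK => /eqP.
  + split=> [x y z|x]; last first.
      rewrite genmxE => xC /(_ x); rewrite genmxE => /(_ xC) xx.
      apply/eqP; apply: contraT => x1.
      have := sum_posdef (S := pred1 b) (x := x); rewrite big_pred1_eq genmxE.
      by move=> /(_ xC x1); rewrite xx ltxx.
    rewrite !genmxE => /CK <- /CK <- /CK <-; rewrite !lbE !prP.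
    rewrite !(frameK (CsI b)).
    by rewrite dotM As mulmxN dotNr addNr.
  split.
    have [y hy] : exists y : 'rV_(d b), y *m A x0 != 0.
      apply: contrapT => h; case/eqP: Ho; apply/row_matrixP => l; rewrite rowE row0.
      by apply/eqP; apply: contraT => hl; case: h; exists (delta_mx 0 l).
    exists (x0 *m C b), (y *m C b); rewrite !genmxE !submxMl; split=> //.
    rewrite lbE; apply: contra hy => /eqP h.
    by rewrite -[y *m _](frameK (CsI b)) h prE !mul0mx.
  move=> I IW II; pose S := I *m G *m (C b)^T.
  have IE : I = S *m C b.
    apply/row_matrixP => i; rewrite row_mul /S !row_mul -prE CK //.
    by rewrite -(genmxE (C b)); apply: submx_trans (row_sub _ _) IW.
  have [S0|S0] := eqVneq S 0; [left|right].
    by apply/eqmxP; rewrite IE S0 mul0mx.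
  rewrite -(andTb (_ == _)%MS); apply/andP; split => //; apply/andP; split => //.
  suff /row_fullP[B BS] : row_full <<S>>%MS.
    have : (1%:M <= S)%MS by rewrite -BS -(genmxE S) submxMl.
    case/submxP => B' B'S; rewrite genmxE -[C b]mul1mx B'S -mulmxA -IE.
    exact: submxMl.
  case: (Cs_irr b) => _; apply => [|X [a [a' ->]]].
    by rewrite -mxrank_eq0 mxrank_gen mxrank_eq0.
  (* Every operator on this frame is inner, so ideals of [lb] are invariant subspaces and
     irreducibility yields simplicity. To see it, split [a] and [a'] into u-parts and parts in
     Z^perp; only the mixed terms survive. *)
  have Dspan : exists q, D (C b) a a' = A q.
    have Dpc (f : 'I_r -> R) c : Zp c -> D (C b) (\sum_i f i *: u i) c =
        A ((\sum_i f i * kappa i) *: pr (C b) c).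
      move=> Zc; rewrite D_C (D_pr (CsI b) _ Zc) -D_C D_suml /A -scalemxAl D_Zr.
      by rewrite scaler_suml; apply: eq_bigr => i _; rewrite D_Zl DK scalerA.
    pose p x : V := \sum_i bform G x (v i) *: u i.
    have Zp_p x : Zp (x - p x) by apply: Zp_dual.
    have Dpp : D (C b) (p a) (p a') = 0.
      rewrite /p D_suml big1 // => i _; rewrite D_Zl D_sumr big1 ?scaler0 // => j _.
      by rewrite D_Zr Duu scaler0.
    have Dcc : D (C b) (a - p a) (a' - p a') = 0.
      rewrite (D_pr (CsI b) _ (Zp_p a)) D_C (D_pr (CsI b) _ (Zp_p a')) D0.
      by rewrite oppr0.
    exists ((- \sum_i (bform G a' (v i) * kappa i)) *: pr (C b) (a - p a)
      + (\sum_i (bform G a (v i) * kappa i)) *: pr (C b) (a' - p a')).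
    have gen c c' q q' : D (C b) c c' = 0 -> D (C b) q q' = 0 ->
        D (C b) (c + q) (c' + q') = - D (C b) q' c + D (C b) q c'.
      by move=> h h'; rewrite D_Dl !D_Dr h h' add0r addr0 [D (C b) c q']D_C.
    transitivity (D (C b) (a - p a + p a) (a' - p a' + p a')); first by rewrite !subrK.
    rewrite AL gen // !Dpc // scaleNr; congr (- _ + _).
    by rewrite /A -scalemxAl D_Zr.
  have [q ->] := Dspan; rewrite (eqmxMr _ (genmxE S)) genmxE.
  apply/row_subP => i; rewrite rowE mulmxA.
  set y : 'rV_n := row i I.
  have yS : delta_mx 0 i *m S = pr (C b) y by rewrite prE -rowE /S !row_mul.
  have yI : (y <= I)%MS by apply: row_sub.
  have : (lb (q *m C b) y <= I)%MS by apply: II yI; rewrite genmxE submxMl.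
  rewrite yS /lb (frameK (CsI b)).
  case/submxP => w wE; apply/submxP; exists w; rewrite /S !mulmxA -wE.
  by rewrite -prE frameK //; apply: CsI.
- move=> i j x /CK <-; rewrite br_uuC // Duu mulmx0 mul0mx //.
- move=> i x y /CK <- /CK <-; rewrite lbE br_uCC DK -scalemxAr -scalemxAl big1 ?addr0 //.
  by move=> l _; rewrite Duu mulmx0 /dot mul0mx mxE scale0r.
move=> x y z /CK <- /CK <- /CK <-; rewrite br_CCC D0 mulmx0 mul0mx add0r.
rewrite lbE prP (frameK (CsI b)).
rewrite scaler_sumr; congr (- _); apply: eq_bigr => l _.
by rewrite DK -scalemxAr dotZl scalerA mulrC.
Qed.

(** * The subspace E_0 and the components K_ijk *)

Section Zero.
Variable S : pred 'I_k.
Hypothesis S0 : forall b, S b -> frame_0 (C b).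
Notation E0 := (\sum_(b | S b) <<C b>>)%MS.
Definition Kpart x : V := \sum_(b | S b) pr (C b) x *m C b.

Lemma Kpart_sub x : (Kpart x <= E0)%MS.
Proof.
apply: summx_sub => b Sb; apply: submx_trans (submxMl _ _) _.
by rewrite (sumsmx_sup b) // genmxE.
Qed.

Lemma KpartN x : Kpart (- x) = - Kpart x.
Proof. by rewrite /Kpart -sumrN; apply: eq_bigr => b _; rewrite prN mulNmx. Qed.

Lemma zero_br a a' x : (x <= E0)%MS ->
  br a a' x = - \sum_l bform G (br a a' (u l)) x *: v l.
Proof.
move=> /sum_expand xE; rewrite [in LHS]xE br_sumr.
under eq_bigr => b Sb do rewrite br_C S0 // mulmx0 mul0mx sub0r.
rewrite sumrN exchange_big; congr (- _); apply: eq_bigr => l _ /=.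
rewrite -scaler_suml [in RHS]xE bform_sumr; congr (_ *: _).
by apply: eq_bigr => b _; rewrite prP.
Qed.

Lemma zero_br_Z a a' x : (x <= E0)%MS -> (br a a' x <= Z)%MS.
Proof.
move=> /zero_br ->; rewrite eqmx_opp; apply: summx_sub => l _.
by apply: scalemx_sub; apply: vZ.
Qed.

(** The coefficients <[c,a,u_l],x> are up to sign <[a,u_l,x],c>, where [a,u_l,x] is central. *)
Lemma zero_br_Zp a c x : (x <= E0)%MS -> Zp c -> br c a x = 0.
Proof.
move=> xE Zc; rewrite zero_br // big1 ?oppr0 // => l _.
rewrite br_rot w34 bformC (Zp_bform Zc (zero_br_Z _ _ xE)).
by rewrite oppr0 scale0r.
Qed.

Lemma uuu_expand i j l : (forall b, ~~ S b -> pr (C b) (br (u i) (u j) (u l)) = 0) ->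
  br (u i) (u j) (u l) = Kpart (br (u i) (u j) (u l)) +
    \sum_p bform G (br (u i) (u j) (u l)) (u p) *: v p.
Proof.
move=> h; rewrite [LHS](Zp_expand (Zp_br _ _ _)); congr (_ + _).
rewrite (bigID S) /= [X in _ + X]big1 ?addr0 // => b Sb.
by rewrite h // mul0mx.
Qed.

Hypothesis HK : forall b i j l, ~~ S b -> pr (C b) (br (u i) (u j) (u l)) = 0.
Notation K i j l := (Kpart (br (u i) (u j) (u l))).

Lemma bform_K i j l c : Zp c -> bform G (K i j l) c = bform G (br (u i) (u j) (u l)) c.
Proof.
move=> Zc; rewrite [in RHS](uuu_expand (fun b => @HK b i j l)) bformDl [X in _ + X]bform_suml.
rewrite [X in _ + X]big1 ?addr0 // => p _.
by rewrite bformZl (bformC (v p)) (Zp_bform Zc (vZ p)) mulr0.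
Qed.

Lemma K_br i j l p q : br (u p) (u q) (K i j l) = br (u p) (u q) (br (u i) (u j) (u l)).
Proof.
rewrite [in RHS](uuu_expand (fun b => @HK b i j l)) brDr [X in _ + X]br_sumr.
rewrite [X in _ + X]big1 ?addr0 // => t _.
by rewrite brZr (br_rot (u p) (u q) (v t)) (br_rot (u q) (v t)) (central_Z _ _ (vZ t)) scaler0.
Qed.

(** This is the fundamental identity for [u_i,u_j,[u_p,u_l,u_m]] paired with u_t; each term is a
    product of two K by [w34], and skewness rearranges the indices. *)
Lemma K_relation i j p l m t :
  bform G (K i j t) (K p l m) + bform G (K i j l) (K m t p)
  - bform G (K i j m) (K t p l) - bform G (K i j p) (K l m t) = 0.
Proof.
pose P a b c a' b' c' := bform G (K a b c) (K a' b' c').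
have PE a b c a' b' c' : P a b c a' b' c' =
    - bform G (br (u a) (u b) (br (u a') (u b') (u c'))) (u c).
  rewrite /P bform_K; last exact: sum_Zp (Kpart_sub _).
  by rewrite w34 K_br.
have Psym a b c a' b' c' : P a b c a' b' c' = P a' b' c' a b c by exact: bformC.
have P12 a b c a' b' c' : P a b c a' b' c' = - P b a c a' b' c'.
  by rewrite /P br12 KpartN bformNl.
have Prot a b c a' b' c' : P a b c a' b' c' = P b c a a' b' c'.
  by rewrite /P br_rot.
have FIP : P i j t p l m = P l m t i j p + P m p t i j l + P p l t i j m.
  rewrite !PE FI !bformDl !opprD; congr (_ + _ + _); congr (- bform G _ _).
    by rewrite br_rot.
  by rewrite -br_rot.
have e1 : P i j l m t p = - P m p t i j l.
  by rewrite Psym [in RHS]P12 opprK [RHS]Prot.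
have e2 : P i j m t p l = P p l t i j m by rewrite Psym Prot.
have e3 : P i j p l m t = P l m t i j p by rewrite Psym.
rewrite -/(P i j t p l m) -/(P i j l m t p) -/(P i j m t p l) -/(P i j p l m t).
rewrite FIP e1 e2 e3; lra.
Qed.

(** Such an x is central, but the centre is orthogonal to E_0, which is positive definite. *)
Lemma zero_nondeg x : (x <= E0)%MS ->
  (forall i j l, bform G (K i j l) x = 0) -> x = 0.
Proof.
move=> xE hx; have Zx := sum_Zp xE.
have xuu i j : br (u i) (u j) x = 0.
  rewrite zero_br // big1 ?oppr0 // => l _.
  by rewrite -bform_K // hx scale0r.
have xZ : (x <= Z)%MS.
  apply/HZ => a a'; rewrite br_rot.
  rewrite -(subrK (\sum_i bform G a (v i) *: u i) a) brDl zero_br_Zp ?add0r //; last exact: Zp_dual.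
  rewrite br_suml big1 // => i _; rewrite brZl.
  rewrite -(subrK (\sum_i bform G a' (v i) *: u i) a') brDm br12 zero_br_Zp ?oppr0 ?add0r //; last exact: Zp_dual.
  by rewrite br_summ big1 ?scaler0 // => j _; rewrite brZm xuu scaler0.
apply/eqP; apply: contraT => x0; have := sum_posdef xE x0.
by rewrite (Zp_bform Zx xZ) ltxx.
Qed.
End Zero.
End Assembly.
End Metric3Lie.

(** * The dimension bound and the final assembly *)

Lemma rank_sum_le (F : fieldType) n (I : finType) (P : pred I) (A : I -> 'M[F]_n) :
  (\rank (\sum_(i | P i) A i)%MS <= \sum_(i | P i) \rank (A i))%N.
Proof.
elim/big_rec2: _ => [|i a B _ IH]; first by rewrite mxrank0.
by apply: leq_trans (mxrank_adds_leqif _ _) _; rewrite leq_add2l.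
Qed.

(** Pairing with the K_ijk for i < j < k is injective on E_0, since skewness recovers the other
    triples; there are C(r,3) strictly increasing ones. *)
Lemma skew3_rank_bound (R : realType) n r (G E0 : 'M[R]_n)
    (K : 'I_r -> 'I_r -> 'I_r -> 'rV[R]_n) :
  G^T = G -> skew3_arr K ->
  (forall x : 'rV_n, (x <= E0)%MS -> (forall i j k, bform G (K i j k) x = 0) -> x = 0) ->
  (\rank E0 <= 'C(r, 3))%N.
Proof.
move=> Gs Ks h; rewrite -card_ltn_sorted_tuples.
set T := [set t : 3.-tuple 'I_r | sorted ltn (map val t)].
pose Kt (t : 3.-tuple 'I_r) := K (tnth t 0) (tnth t 1) (tnth t 2).
pose KS := \matrix_(s < #|T|) Kt (enum_val s).
suff : row_free (row_base E0 *m G *m KS^T) by move/eqP <-; apply: rank_leq_col.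
rewrite -kermx_eq0; apply/eqP/row_matrixP => l; rewrite row0.
set w := row l _; have wM : w *m (row_base E0 *m G *m KS^T) = 0.
  by rewrite /w -row_mul mulmx_ker row0.
pose x := w *m row_base E0.
suff x0 : x = 0.
  by apply: (row_free_inj (row_base_free E0)); rewrite -/x x0 mul0mx.
have xE : (x <= E0)%MS by rewrite -(eq_row_base E0) submxMl.
have xK : x *m G *m KS^T = 0 by rewrite -wM /x !mulmxA.
apply: h => // i j k.
have sorted_K (a b c : 'I_r) : (a < b < c)%N -> bform G (K a b c) x = 0.
  case/andP => ab bc; have tT : [tuple a; b; c] \in T by rewrite inE /= ab bc.
  have -> : K a b c = row (enum_rank_in tT [tuple a; b; c]) KS.
    by rewrite rowK enum_rankK_in.
  have /bform_eq0 hx := xK; rewrite !bformE dotM Gs dotC; apply: hx.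
  exact: row_sub.
have s12 a b c : bform G (K b a c) x = 0 -> bform G (K a b c) x = 0.
  by case: (Ks a b c) => -> _; rewrite bformNl => ->; rewrite oppr0.
have s23 a b c : bform G (K a c b) x = 0 -> bform G (K a b c) x = 0.
  by case: (Ks a b c) => _ ->; rewrite bformNl => ->; rewrite oppr0.
have K11 a c : K a a c = 0 by apply: (@eq_oppr0 R _); case: (Ks a a c).
have K22 a c : K a c c = 0 by apply: (@eq_oppr0 R _); case: (Ks a c c).
have le12 (a b c : 'I_r) : (a <= b)%N -> (b <= c)%N -> bform G (K a b c) x = 0.
  rewrite leq_eqVlt => /orP[/eqP/val_inj ->|ab]; first by rewrite K11 bform0l.
  rewrite leq_eqVlt => /orP[/eqP/val_inj ->|bc]; first by rewrite K22 bform0l.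
  by apply: sorted_K; rewrite ab.
have := leq_total i j; have := leq_total j k; have := leq_total i k.
case/orP => ik /orP[jk|jk] /orP[ij|ij].
- exact: le12.
- by apply: s12; apply: le12.
- by apply: s23; apply: le12.
- by apply: s12; apply: le12.
- exact: le12.
- by apply: s12; apply: s23; apply: le12.
- by apply: s23; apply: s12; apply: le12.
- by apply: (s23); apply: s12; apply: s23; apply: le12.
Qed.

Theorem mainTheorem1 (R : realType) (n r : nat) (G : 'M[R]_n)
    (br : 'rV[R]_n -> 'rV[R]_n -> 'rV[R]_n -> 'rV[R]_n) :
  is_3Lie br -> is_metric3 G br -> index_of G r -> (0 < r)%N ->
  indecomposable G br -> max_isotropic_centre G br r ->
  exists (M N : nat) (u v : 'I_r -> 'rV[R]_n)
         (W : 'I_N -> 'M[R]_n) (E : 'I_M -> 'M[R]_n) (E0 : 'M[R]_n)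
         (eta zeta : 'I_M -> 'I_r -> R) (kappa : 'I_N -> 'I_r -> R)
         (lb : 'I_N -> 'rV[R]_n -> 'rV[R]_n -> 'rV[R]_n)
         (L : 'I_r -> 'I_r -> 'I_r -> 'I_r -> R)
         (K : 'I_r -> 'I_r -> 'I_r -> 'rV[R]_n)
         (H : 'I_M -> 'rV[R]_n -> 'rV[R]_n),
  (* --- the decomposition of V into mutually orthogonal subspaces --- *)
  [/\ (\sum_(i < r) (<<u i>> + <<v i>>) + \sum_(a < N) W a
        + \sum_(p < M) E p + E0 == (1%:M : 'M[R]_n))%MS,
      n = (2 * r + \sum_(a < N) \rank (W a) + \sum_(p < M) \rank (E p)
           + \rank E0)%N,
      forall i j, [/\ bform G (u i) (u j) = 0, bform G (v i) (v j) = 0 &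
                      bform G (u i) (v j) = (i == j)%:R],
      forall i, [/\ (forall a, orth G (u i) (W a) /\ orth G (v i) (W a)),
                    (forall p, orth G (u i) (E p) /\ orth G (v i) (E p)) &
                    (orth G (u i) E0 /\ orth G (v i) E0)] &
      [/\ forall a b, a != b -> orth G (W a) (W b),
          forall p q, p != q -> orth G (E p) (E q),
          forall a p, orth G (W a) (E p),
          forall a, orth G (W a) E0 &
          forall p, orth G (E p) E0]] /\
  [/\ (forall a, posdef G (W a)), (forall p, posdef G (E p)), posdef G E0 &
      forall p, \rank (E p) = 2%N] /\
  (* --- the data --- *)
  [/\ forall p, exists i j, Jc eta zeta p i j != 0,
      forall a, exists i, kappa a i != 0,
      forall a, metric_simple_Lie G (W a) (lb a),
      skew4_arr L &
      [/\ skew3_arr K, forall i j k, (K i j k <= E0)%MS,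
          forall i j k l m n',
            bform G (K i j n') (K k l m) + bform G (K i j l) (K m n' k)
            - bform G (K i j m) (K n' k l) - bform G (K i j k) (K l m n') = 0 &
          forall p, complex_structure (E p) (H p)]] /\
  (* --- the 3-brackets (all others follow by trilinearity and skewsymmetry) --- *)
  [/\ forall i x y, br (v i) x y = 0,
      forall i j k, br (u i) (u j) (u k) = K i j k + \sum_(l < r) L i j k l *: v l,
      forall i j x, (x <= E0)%MS ->
        br (u i) (u j) x = - \sum_(k < r) bform G (K i j k) x *: v k,
      forall p i j x, (x <= E p)%MS ->
        br (u i) (u j) x = Jc eta zeta p i j *: H p x &
      [/\ forall a i j x, (x <= W a)%MS -> br (u i) (u j) x = 0,
          forall i A B x y, (x <= piece_sp E0 E W A)%MS ->
            (y <= piece_sp E0 E W B)%MS ->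
            br (u i) x y = br_uxy G v eta zeta H kappa lb i A B x y &
          forall A B C x y z, (x <= piece_sp E0 E W A)%MS ->
            (y <= piece_sp E0 E W B)%MS -> (z <= piece_sp E0 E W C)%MS ->
            br x y z = br_xyz G v kappa lb A B C x y z]] /\
  (* --- indecomposability forces the K_ijk to span E_0 --- *)
  (forall x, (x <= E0)%MS -> (forall i j k, bform G (K i j k) x = 0) -> x = 0) /\
  (\rank E0 <= 'C(r, 3))%N.
Proof.
move=> HL HM Hidx r_gt0 Hind [Z [HZ Zr Ziso]]; subst r.
pose v i := row i (row_base Z).
have vZ i : (v i <= Z)%MS by rewrite -(eq_row_base Z) row_sub.
have Zv : (Z <= \matrix_i v i)%MS.
  have -> : \matrix_i v i = row_base Z by apply/row_matrixP => i; rewrite rowK.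
  by rewrite eq_row_base.
have HZ0 : Z *m G *m Z^T = 0.
  apply/row_matrixP => i; rewrite row0 !row_mul; apply/bform_eq0 => z zZ.
  by apply: Ziso => //; apply: row_sub.
have vv i j : bform G (v i) (v j) = 0 by apply: Ziso.
have [u [k [Cs [[du uu] CsP Csorth nE Cspan]]]] :=
  normal_form HL HM HZ HZ0 vZ Zv Hidx (erefl _) r_gt0 Hind.
pose C (b : 'I_k) := fm (Cs b).
have cross := br_cross HL HM CsP Csorth.
have orthC := orth_cross CsP Csorth.
have perpu := sum_perp_u CsP Csorth.
have sumZp := sum_Zp CsP Csorth.
have posC := sum_posdef HM HZ0 Zv Hidx (erefl _) r_gt0 du CsP Csorth Cspan.
have perpv S x i : (x <= \sum_(b | S b) <<C b>>)%MS -> bform G x (v i) = 0.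
  by move=> xS; apply: Zp_bform (vZ i); apply: sumZp xS.
pose SW := [set b : 'I_k | `[< frame_W G br (C b) u >]].
(* [SW] is excluded so that [SW], [SE] and [S0] partition the frames. *)
pose SE := [set b : 'I_k | (b \notin SW) && `[< frame_E G br (C b) u >]].
pose S0 (b : 'I_k) := (b \notin SW) && (b \notin SE).
(* Choice asks for data at every b; outside [SW] they are zero placeholders. *)
have /choice[dW hW] (b : 'I_k) : exists p : ('I_(\rank Z) -> R) * ('rV[R]_n -> 'rV[R]_n -> 'rV[R]_n),
    b \in SW -> W_data G br v u Cs b p.1 p.2.
  case: (boolP (b \in SW)) => [|_]; last by exists ((fun=> 0), (fun _ _ => 0)).
  rewrite inE => /asboolP/(frame_W_data HL HM HZ HZ0 Zv Hidx (erefl _) r_gt0 du CsP Csorth Cspan).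
  by case=> kappa [lb h]; exists (kappa, lb).
have /choice[dE hE] (b : 'I_k) : exists p : ('I_(\rank Z) -> R) * ('I_(\rank Z) -> R) * ('rV[R]_n -> 'rV[R]_n),
    b \in SE -> E_data G br v u Cs b p.1.1 p.1.2 p.2.
  case: (boolP (b \in SE)) => [|_]; last by exists ((fun=> 0), (fun=> 0), (fun _ => 0)).
  rewrite inE => /andP[_ /asboolP/(frame_E_data HL HM HZ Zv du CsP Csorth Cspan)].
  by case=> eta [zeta [H h]]; exists (eta, zeta, H).
have h0 b : S0 b -> frame_0 G br (C b).
  rewrite /S0 !inE; case/andP => /asboolP nW; rewrite negb_and negbK => /orP[/asboolP//|/asboolP nE'].
  by case: (CsP b (ltn_ord b)) => _ _ _ [].
have hK b i j l : ~~ S0 b -> pr G (C b) (br (u i) (u j) (u l)) = 0.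
  rewrite negb_and !negbK => /orP[|]; rewrite inE.
    by move=> /asboolP[_ [o [kap [_ _ _ _ ->]]]].
  by move=> /andP[_ /asboolP[_ [_ [J [eta [zeta [_ _ _ ->]]]]]]].
pose E0 := (\sum_(b | S0 b) <<C b>>)%MS : 'M_n.
pose W (a : 'I_#|SW|) := <<C (enum_val a)>>%MS.
pose E (p : 'I_#|SE|) := <<C (enum_val p)>>%MS.
pose K i j l := Kpart G Cs S0 (br (u i) (u j) (u l)).
pose L i j l p := bform G (br (u i) (u j) (u l)) (u p).
exists #|SE|, #|SW|, u, v, W, E, E0, (fun p => (dE (enum_val p)).1.1),
  (fun p => (dE (enum_val p)).1.2), (fun a => (dW (enum_val a)).1),
  (fun a => (dW (enum_val a)).2), L, K, (fun p => (dE (enum_val p)).2).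
have sub1 (b : 'I_k) : (<<C b>> <= \sum_(c | c == b) <<C c>>)%MS by rewrite big_pred1_eq.
(* Each piece is a set of frames. Two pieces coincide or have disjoint sets, so all cross terms
   follow from [orthC] and [cross]. *)
pose ix (A : piece #|SE| #|SW|) : pred 'I_k :=
  match A with P0 => S0 | PE p => pred1 (enum_val p) | PW a => pred1 (enum_val a) end.
have ixP A (x : 'rV[R]_n) : (x <= piece_sp E0 E W A)%MS -> (x <= \sum_(b | ix A b) <<C b>>)%MS.
  by case: A => [|p|a] //= xA; apply: submx_trans xA (sub1 _).
have WE b : b \in SW -> b \in SE -> False by move=> h; rewrite inE h.
have dis A B : A = B \/ (forall b, ix A b -> ix B b -> False).
  case: A => [|p|a]; case: B => [|q|c] /=; try by left.
  - by right=> b /andP[_ /negP h] /eqP e; apply: h; rewrite e enum_valP.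
  - by right=> b /andP[/negP h _] /eqP e; apply: h; rewrite e enum_valP.
  - by right=> b /eqP -> /andP[_ /negP]; apply; apply: enum_valP.
  - have [->|pq] := eqVneq p q; [by left|right=> b /eqP -> /eqP /enum_val_inj /eqP].
    by rewrite (negPf pq).
  - by right=> b /eqP -> /eqP e; apply: (WE (enum_val p)); rewrite ?enum_valP // e enum_valP.
  - by right=> b /eqP -> /andP[/negP]; rewrite enum_valP.
  - by right=> b /eqP -> /eqP e; apply: (WE (enum_val a)); rewrite ?enum_valP // e enum_valP.
  have [->|pq] := eqVneq a c; [by left|right=> b /eqP -> /eqP /enum_val_inj /eqP].
  by rewrite (negPf pq).
have orthP A B : A <> B -> orth G (piece_sp E0 E W A) (piece_sp E0 E W B).
  move=> AB x y /ixP xA /ixP yB; case: (dis A B) => // h.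
  exact: orthC h xA yB.
have orthu A i : orth G (u i) (piece_sp E0 E W A) /\ orth G (v i) (piece_sp E0 E W A).
  split=> x y /sub_rVP[c ->] /ixP yA; rewrite bformZl (bformC HM).
    by rewrite (perpu _ _ _ yA) mulr0.
  by rewrite (perpv _ _ _ yA) mulr0.
have rC (b : 'I_k) : \rank <<C b>>%MS = tag (Cs b).
  by rewrite mxrank_gen; case: (CsP b (ltn_ord b)) => HC _ _ _; rewrite (frame_rank (frameCC HC)).
have posP A : posdef G (piece_sp E0 E W A).
  by move=> x /ixP xA x0; apply: posC xA x0.
have span : (1%:M <= \sum_(i < \rank Z) (<<u i>> + <<v i>>) + \sum_(a < #|SW|) W a
        + \sum_(p < #|SE|) E p + E0)%MS.
  apply/row_subP => l; set y := row l _; set T := (_ + E0)%MS.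
  have uT i : (u i <= T)%MS /\ (v i <= T)%MS.
    have h : (<<u i>> + <<v i>> <= T)%MS.
      do 3 apply: submx_trans _ (addsmxSl _ _).
      exact: sumsmx_sup.
    split; apply: submx_trans _ h.
      by have := addsmxSl <<u i>>%MS <<v i>>%MS; rewrite (genmxE (u i)).
    by have := addsmxSr <<u i>>%MS <<v i>>%MS; rewrite (genmxE (v i)).
  have CT b : (C b <= T)%MS.
    rewrite -(genmxE (C b)); case: (boolP (b \in SW)) => bW.
      do 2 apply: submx_trans _ (addsmxSl _ _); apply: submx_trans _ (addsmxSr _ _).
      by apply: (sumsmx_sup (enum_rank_in bW b)) => //; rewrite /W enum_rankK_in.
    case: (boolP (b \in SE)) => bE.
      do 1 apply: submx_trans _ (addsmxSl _ _); apply: submx_trans _ (addsmxSr _ _).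
      by apply: (sumsmx_sup (enum_rank_in bE b)) => //; rewrite /E enum_rankK_in.
    by apply: submx_trans _ (addsmxSr _ _); apply: (sumsmx_sup b); rewrite /S0 ?bW.
  rewrite -(subrK (\sum_i bform G y (v i) *: u i) y) addmx_sub //.
    rewrite (Zp_expand HM Zv du CsP Csorth Cspan (Zp_dual Zv y du)) addmx_sub //.
      by apply: summx_sub => b _; apply: submx_trans (submxMl _ _) (CT b).
    by apply: summx_sub => i _; apply: scalemx_sub; case: (uT i).
  by apply: summx_sub => i _; apply: scalemx_sub; case: (uT i).
have rW a : \rank (W a) = tag (Cs (enum_val a)) by rewrite rC.
have rE p : \rank (E p) = tag (Cs (enum_val p)) by rewrite rC.
have rE2 p : \rank (E p) = 2%N.
  by rewrite rE; have := enum_valP p; rewrite inE => /andP[_ /asboolP[]].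
have K0 := zero_nondeg HL HM HZ HZ0 vZ Zv Hidx (erefl _) r_gt0 du CsP Csorth Cspan h0 hK.
split; [|split; [|split; [|split; [|split]]]].
- split.
  + by apply/andP; split; [apply: submx1|].
  + have rs : (\sum_(b < k) tag (Cs b) = \sum_(a < #|SW|) \rank (W a) +
      \sum_(p < #|SE|) \rank (E p) + \sum_(b | S0 b) tag (Cs b))%N.
      rewrite (eq_bigr _ (fun a _ => rW a)) (eq_bigr _ (fun p _ => rE p)).
      rewrite -!(big_enum_val (fun b : 'I_k => tag (Cs b))).
      rewrite [LHS](bigID (mem SW)) /= -addnA; congr (_ + _)%N.
      rewrite [LHS](bigID (mem SE)) /=; congr (_ + _)%N; apply: eq_bigl => b.
      by rewrite [b \in SE]inE andbA andbb.
    have := mxrankS span; rewrite mxrank1 => h1.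
    have h2 : (\rank E0 <= \sum_(b | S0 b) tag (Cs b))%N.
      apply: leq_trans (rank_sum_le _ _) _; apply: leq_sum => b _.
      by rewrite rC.
    have h3 : (\rank (\sum_(i < \rank Z) (<<u i>> + <<v i>>))%MS <= 2 * \rank Z)%N.
      apply: leq_trans (rank_sum_le _ _) _.
      rewrite mulnC -[X in (_ <= X * _)%N]card_ord -sum_nat_const; apply: leq_sum => i _.
      apply: leq_trans (mxrank_adds_leqif _ _) _.
      by rewrite !mxrank_gen (leq_add (rank_leq_row _) (rank_leq_row _)).
    have h4 := rank_sum_le xpredT W; have h5 := rank_sum_le xpredT E.
    have h6 := (mxrank_adds_leqif (\sum_(i < \rank Z) (<<u i>> + <<v i>>) +
      \sum_(a < #|SW|) W a + \sum_(p < #|SE|) E p)%MS E0).1.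
    have h7 := (mxrank_adds_leqif (\sum_(i < \rank Z) (<<u i>> + <<v i>>) +
      \sum_(a < #|SW|) W a)%MS (\sum_(p < #|SE|) E p)%MS).1.
    have h8 := (mxrank_adds_leqif (\sum_(i < \rank Z) (<<u i>> + <<v i>>))%MS
      (\sum_(a < #|SW|) W a)%MS).1.
    (* The ranks are bounded above by the frame sizes, and the pieces span V, so all these
       inequalities are equalities. *)
    have squeeze (N t w e s e0 T1 T2 T3 t0 w0 p0 : nat) : (N = t + (w + e + s) ->
        N <= T1 -> e0 <= s -> t0 <= t -> w0 <= w -> p0 <= e -> T1 <= T2 + e0 ->
        T2 <= T3 + p0 -> T3 <= t0 + w0 -> N = t + w + e + e0)%N.
      by move=> *; lia.
    by rewrite rs in nE; apply: squeeze nE h1 h2 h3 h4 h5 h6 h7 h8.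
  + by move=> i j; rewrite uu vv du.
  + move=> i; split=> [a|p|]; first exact: (orthu (PW a) i).
      exact: (orthu (PE p) i).
    exact: (orthu P0 i).
  split=> [a b ab|p q pq|a p|a|p].
  + by apply: (orthP (PW a) (PW b)) => -[] /eqP; apply/negP.
  + by apply: (orthP (PE p) (PE q)) => -[] /eqP; apply/negP.
  + exact: (orthP (PW a) (PE p)).
  + exact: (orthP (PW a) P0).
  + exact: (orthP (PE p) P0).
- split=> //; [move=> a; exact: (posP (PW a))|move=> p; exact: (posP (PE p))|].
  exact: (posP P0).
- have Kskew : skew3_arr K.
    by split; rewrite /K -KpartN; [rewrite -(br12 HL)|rewrite -(br23 HL)].
  split.
  + by move=> p; case: (hE _ (enum_valP p)).
  + by move=> a; case: (hW _ (enum_valP a)).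
  + by move=> a; case: (hW _ (enum_valP a)).
  + move=> i j l p; rewrite /L; split; last exact: (w34 HM).
      by rewrite (br12 HL) bformNl.
    by rewrite (br23 HL) bformNl.
  split=> //.
  + by move=> i j l; apply: Kpart_sub.
  + exact: (K_relation HL HM HZ vZ Zv du CsP Csorth Cspan hK).
  by move=> p; case: (hE _ (enum_valP p)).
- split.
  + by move=> i x y; apply: (central_Z HZ).
  + move=> i j l; apply: (uuu_expand HL HM HZ Zv du CsP Csorth Cspan) => b.
    exact: hK.
  + move=> i j x xE; rewrite (zero_br HL HM HZ Zv du CsP Csorth Cspan h0 _ _ xE).
    congr (- _); apply: eq_bigr => l _; congr (_ *: _).
    rewrite /K (bform_K HL HM HZ vZ Zv du CsP Csorth Cspan hK) //.
    exact: sumZp xE.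
  + move=> p i j x; rewrite genmxE => xE; case: (hE _ (enum_valP p)) => _ _ h _ _.
    exact: h.
  split.
  + move=> a i j x; rewrite genmxE => xW; case: (hW _ (enum_valP a)) => _ _ h _ _.
    exact: h.
  + move=> i A B x y xA yB; case: (dis A B) => [eAB|h]; last first.
      rewrite (cross _ _ _ _ _ h (ixP _ _ xA) (ixP _ _ yB)).
      case: A B xA yB h => [|p|a] [|q|c] //= _ _ h.
        by have [e|//] := eqVneq p q; case: (h (enum_val p)); rewrite /= ?e.
      by have [e|//] := eqVneq a c; case: (h (enum_val a)); rewrite /= ?e.
    subst B; case: A xA yB => [|p|a] /= xA yB.
    * rewrite (br12 HL) (zero_br_Zp HL HM HZ vZ Zv du CsP Csorth Cspan h0) ?oppr0 //.
      exact: sumZp xA.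
    * rewrite eqxx; move: xA yB; rewrite !genmxE => xA yB.
      by case: (hE _ (enum_valP p)) => _ _ _ h _; rewrite h.
    rewrite eqxx; move: xA yB; rewrite !genmxE => xA yB.
    by case: (hW _ (enum_valP a)) => _ _ _ h _; rewrite h.
  move=> A B D x y z xA yB zD.
  have piece0 : (A = B -> B = D -> False) -> br_xyz G v (fun a => (dW (enum_val a)).1)
      (fun a => (dW (enum_val a)).2) A B D x y z = 0.
    case: A B D {xA yB zD} => [|p|a] [|q|b] [|t|c] //= h.
    by case: eqVneq => [ab|//]; case: eqVneq => [bc|//]; case: h; rewrite ?ab ?bc.
  case: (pselect (B = D)) => [eBD|nBD]; last first.
    have [//|h] := dis B D.
    by rewrite (cross _ _ _ _ _ h (ixP _ _ yB) (ixP _ _ zD)) piece0.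
  case: (pselect (A = B)) => [eAB|nAB]; last first.
    have [//|h] := dis A B.
    by rewrite -(br_rot HL) (cross _ _ _ _ _ h (ixP _ _ xA) (ixP _ _ yB)) piece0.
  subst B D; case: A xA yB zD {piece0} => [|p|a] /= xA yB zD.
  * rewrite (zero_br_Zp HL HM HZ vZ Zv du CsP Csorth Cspan h0) //.
    exact: sumZp xA.
  * move: xA yB zD; rewrite !genmxE => xA yB zD.
    by case: (hE _ (enum_valP p)) => _ _ _ _ h; apply: h.
  rewrite !eqxx; move: xA yB zD; rewrite !genmxE => xA yB zD.
  by case: (hW _ (enum_valP a)) => _ _ _ _ h; apply: h.
- exact: K0.
apply: (@skew3_rank_bound R n _ G E0 K (G_sym HM)).
- by split; rewrite /K -KpartN; [rewrite -(br12 HL)|rewrite -(br23 HL)].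
exact: K0.
Qed.
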